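(* Let $d$ and $k$ be integers with $1\le k\le d-1$. There is a constant $C=C(d,k)>0$ depending only on $d$ and $k$ such that the following holds. Let $\Lambda\subseteq\mathbb{R}^d$ be a $d$-dimensional lattice and let $K\subseteq\mathbb{R}^d$ be a $d$-dimensional compact convex body symmetric about the origin, and write $\lambda_i=\lambda_i(\Lambda,K)$ for $i=1,\dots,d$. If $\lambda_d\le 1$, then $\Lambda\cap K$ can be covered by at most $C\,\alpha^{d-k}$ $k$-dimensional linear subspaces of $\mathbb{R}^d$, where \[\alpha = \min_{1\le j\le k}(\lambda_j\cdots\lambda_d)^{-1/(d-j)}.\]
   Context: A $d$-dimensional lattice is the set of all integer linear combinations of $d$ linearly independent vectors of $\mathbb{R}^d$. For a lattice $\Lambda$ and a compact convex body $K$ symmetric about the origin ($K=-K$), the $i$th successive minimum is $\lambda_i(\Lambda,K)=\inf\{\lambda\in\mathbb{R}:\dim(\Lambda\cap(\lambda K))\ge i\}$, where $\dim$ denotes the dimension of the affine hull. A family of sets covers a point set $P$ if every point of $P$ lies in some set of the family. *)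

(* Defs.v *)
From HB Require Import structures.
From mathcomp Require Import all_boot all_order all_algebra.
From mathcomp Require Import all_classical all_reals all_analysis.
Set Implicit Arguments. Unset Strict Implicit. Unset Printing Implicit Defensive.
Import Order.TTheory GRing.Theory Num.Theory.
Import numFieldNormedType.Exports.
Local Open Scope classical_set_scope.
Local Open Scope ring_scope.

Definition is_lattice (R : realType) (d : nat) (L : set 'rV[R]_d) : Prop :=
  exists B : 'M[R]_d, \det B != 0 /\
    L = [set v | exists z : 'rV[int]_d, v = map_mx (fun a : int => a%:~R) z *m B].

Definition convex_set (R : realType) (d : nat) (K : set 'rV[R]_d) : Prop :=
  forall x y, K x -> K y -> forall t : R, 0 <= t <= 1 -> K (t *: x + (1 - t) *: y).

Definition symmetric_set (R : realType) (d : nat) (K : set 'rV[R]_d) : Prop :=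
  forall x, K x -> K (- x).

Definition sym_convex_body (R : realType) (d : nat) (K : set 'rV[R]_d) : Prop :=
  compact K /\ convex_set K /\ symmetric_set K /\ interior K !=set0.

Definition affdim_ge (R : realType) (d : nat) (S : set 'rV[R]_d) (i : nat) : Prop :=
  exists x0 : 'rV[R]_d, S x0 /\
    exists X : 'M[R]_(i, d), row_free X /\ forall r : 'I_i, S (x0 + row r X).

Definition succ_min (R : realType) (d : nat) (L K : set 'rV[R]_d) (i : nat) : R :=
  inf [set lam : R | 0 < lam /\ affdim_ge (L `&` [set lam *: x | x in K]) i].

Definition alpha_term (R : realType) (d : nat) (L K : set 'rV[R]_d) (j : nat) : R :=
  powR (\prod_(j <= i < d.+1) succ_min L K i) (- (d - j)%:R^-1).

Definition alpha (R : realType) (d k : nat) (L K : set 'rV[R]_d) : R :=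
  \big[Num.min/alpha_term L K 1]_(1 <= j < k.+1) alpha_term L K j.

(* The family s (row spaces of k x d matrices of rank k, i.e. k-dimensional
   linear subspaces) covers P. *)
Definition covers_by_subspaces (R : realType) (d k : nat)
  (s : seq 'M[R]_(k, d)) (P : set 'rV[R]_d) : Prop :=
  (forall U, U \in s -> row_free U) /\
  forall v, P v -> exists2 U, U \in s & (v <= U)%MS.

(* Main.v *)
Require Import Defs.
From HB Require Import structures.
From mathcomp Require Import all_boot all_order all_algebra.
From mathcomp Require Import all_classical all_reals all_analysis.
From mathcomp Require Import ring lra zify.
Import Order.TTheory GRing.Theory Num.Theory.
Import numFieldNormedType.Exports.
Local Open Scope classical_set_scope.
Local Open Scope ring_scope.

Set Implicit Arguments.
Unset Strict Implicit.
Unset Printing Implicit Defensive.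

(* The lattice points in the unit ball of a norm are, up to constants, the
   integer points of a box: a basis c_i obtained by repeatedly taking a nearly shortest
   vector and passing to the quotient norm satisfies |x_i| N(c_i) <= C N(x) for
   x = sum x_i c_i, and N(c_i) is, up to a constant, at least the i-th
   successive minimum.  So the coordinates of the points of L `&` K satisfy
   |x_i| <= n_i with n_i of order 1/lambda_i, and dropping the first j-1
   coordinates reduces the claim for the j-th term of the minimum to a box.

   A box in d+1 dimensions with V = prod n_i is covered by s subspaces of
   dimension k+1, where s rho^k <= C (V + rho^d) for each rho >= 1; rho of order
   V^(1/d) is the case of interest, but only the form that is linear in V can be
   summed.  The induction on d takes r of order V^(1/d).  A coordinate with
   n_i > r is dropped.  Otherwise each x in the box is orthogonal, by the
   pigeonhole principle, to a primitive z with |z_i| <= r / n_i.  There are O(r)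
   such z, the hyperplane of z contains O(V / max |z_i| n_i) points of the box,
   and the sum of these numbers over all z is O(V).  In each hyperplane the box
   norm is again comparable to a box, and the induction hypothesis with rho = r
   applies. *)

(** * Integer vectors and unimodular matrices *)

Local Notation toR R := (map_mx (@intmul R 1)).

(** The Smith form of a one-row matrix has at most one nonzero entry. The row of [W] later serves as
    a primitive vector that extends to a basis. *)
Lemma unimodular_multiple_of_row d (b : 'rV[int]_d.+1) :
  exists W : 'M[int]_d.+1, exists g : int, W \in unitmx /\ b = g *: row 0 W.
Proof.
have [L _ [W uW [e _ ->]]] := int_Smith_normal_form b.
exists W, (L 0 0 * e`_0); split=> //.
apply/rowP => j; rewrite !mxE (bigD1 0) //= big1 ?addr0.
  by rewrite !mxE big_ord1 !mxE mulr1n.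
by case=> -[|i] //= hi _; rewrite !mxE big_ord1 !mxE /= mulr0n mulr0 mul0r.
Qed.

Lemma int_norm_ge1 (R : realType) (z : int) : z != 0 -> 1 <= `|z%:~R : R|.
Proof. by move=> z0; rewrite -intr_norm ler1z; lia. Qed.

Lemma toR_inj (R : realType) m n : 
  injective (map_mx (@intmul R 1) : 'M[int]_(m, n) -> 'M[R]_(m, n)).
Proof.
move=> A B /matrixP h; apply/matrixP => i j; have := h i j.
by rewrite !mxE => /intr_inj.
Qed.

Lemma toR_unitmx (R : realType) d (W : 'M[int]_d) :
  W \in unitmx -> toR R W \in unitmx.
Proof.
rewrite !unitmxE det_map_mx => /unitrP [y [h1 h2]]; apply/unitrP.
by exists y%:~R; rewrite -!intrM h1 h2.
Qed.

(** * Norms and reduced bases *)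

(** Definiteness is a lower bound by the coordinates: in this form it passes to quotients and to
    row-free substitutions without compactness. Equality in the scaling rule follows by applying it
    to [a^-1] as well. *)
Definition norm_on (R : realType) d (N : 'rV[R]_d -> R) : Prop :=
  [/\ forall x y, N (x + y) <= N x + N y,
      forall a x, N (a *: x) <= `|a| * N x &
      exists2 c : R, 0 < c & forall (x : 'rV_d) i, c * `|x 0 i| <= N x].

Section NormTheory.
Variables (R : realType) (d : nat) (N : 'rV[R]_d -> R).
Hypothesis hN : norm_on N.

Lemma norm_onD x y : N (x + y) <= N x + N y.
Proof. by case: hN. Qed.

Lemma norm_on_ge0 x : 0 <= N x.
Proof.
have [hD hZ _] := hN.
have h0 : N 0 <= 0 by have := hZ 0 0; rewrite scale0r normr0 mul0r.
have h1 : N (- x) <= N x by have := hZ (-1) x; rewrite scaleN1r normrN1 mul1r.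
have h2 : 0 <= N 0 by have := hD 0 0; rewrite addr0; lra.
have := hD x (- x); rewrite subrr; lra.
Qed.

Lemma norm_onZ a x : N (a *: x) = `|a| * N x.
Proof.
have [hD hZ _] := hN.
apply/eqP; rewrite eq_le hZ /=.
have [->|a0] := eqVneq a 0; first by rewrite normr0 mul0r norm_on_ge0.
have := hZ a^-1 (a *: x); rewrite scalerA mulVf // scale1r normfV.
by rewrite -ler_pdivrMl ?invr_gt0 ?normr_gt0 // invrK.
Qed.

Lemma norm_on_gt0 x : x != 0 -> 0 < N x.
Proof.
move=> x0; have [_ _ [c c0 hc]] := hN.
have /rV0Pn [i xi] : x != 0 by [].
by apply: lt_le_trans (hc x i); rewrite mulr_gt0 ?normr_gt0.
Qed.

Lemma norm_on_sum (I : finType) (F : I -> 'rV[R]_d) :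
  N (\sum_i F i) <= \sum_i N (F i).
Proof.
elim/big_ind2: _ => // [|x1 x2 y1 y2 h1 h2].
  by have := norm_onZ 0 0; rewrite scale0r normr0 mul0r => ->.
by apply: le_trans (norm_onD _ _) _; exact: lerD.
Qed.

Lemma norm_on_comp m (A : 'M[R]_(m, d)) :
  row_free A -> norm_on (fun x : 'rV[R]_m => N (x *m A)).
Proof.
move=> /row_freeP [B AB]; have [_ _ [c c0 hc]] := hN; split.
- by move=> x y; rewrite mulmxDl norm_onD.
- by move=> a x; rewrite -scalemxAl norm_onZ.
pose M := 1 + \sum_j \sum_i `|B i j|.
have M0 : 0 < M by rewrite ltr_pwDl // sumr_ge0 // => j _; rewrite sumr_ge0.
exists (c / M) => [|x i]; first by rewrite divr_gt0.
rewrite mulrAC ler_pdivrMr //.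
have -> : x 0 i = \sum_j (x *m A) 0 j * B j i.
  by rewrite -[in LHS](mulmx1 x) -AB mulmxA mxE.
apply: le_trans (ler_wpM2l (ltW c0) (ler_norm_sum _ _ _)) _.
rewrite mulr_sumr.
apply: (@le_trans _ _ (\sum_j N (x *m A) * `|B j i|)).
  by apply: ler_sum => j _; rewrite normrM mulrA ler_wpM2r.
rewrite -mulr_sumr ler_wpM2l ?norm_on_ge0 //.
rewrite /M (bigD1 i) //= addrA [1 + _]addrC -addrA lerDl addr_ge0 //.
by rewrite sumr_ge0 // => j _; rewrite sumr_ge0.
Qed.

End NormTheory.

Lemma int_row_norm_ge (R : realType) d (N : 'rV[R]_d -> R) : norm_on N ->
  exists2 c : R, 0 < c & forall v : 'rV[int]_d, v != 0 -> c <= N (toR R v).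
Proof.
case=> _ _ [c c0 hc]; exists c => // v /rV0Pn [i vi].
apply: le_trans (hc _ i); rewrite mxE ler_peMr ?int_norm_ge1 //.
exact: ltW.
Qed.

(* The constant 3/2 < 2 is what makes the rounding step in
   [quot_norm_lift] work. *)
Lemma near_shortest (R : realType) d (N : 'rV[R]_d.+1 -> R) : norm_on N ->
  exists2 W : 'M[int]_d.+1, W \in unitmx &
    forall v, v != 0 -> N (toR R (row 0 W)) <= 3 / 2 * N (toR R v).
Proof.
move=> hN; have [c c0 hc] := int_row_norm_ge hN.
pose E := [set N (toR R v) | v in [set v : 'rV[int]_d.+1 | v != 0]].
have E0 : E !=set0.
  exists (N (toR R (delta_mx 0 0))), (delta_mx 0 0) => //=.
  by apply/rV0Pn; exists 0; rewrite mxE.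
have lbE : lbound E c by move=> _ [v v0 <-]; exact: hc.
have infE : c <= inf E by exact: lb_le_inf.
have [||_ [b b0 <-] hb] := @inf_adherent R E (inf E / 2).
- by rewrite divr_gt0 // (lt_le_trans c0).
- by split=> //; exists c.
(* The near-minimizer [b] may be a proper multiple of a primitive vector; as [g] is a nonzero
   integer, the row of [W] is no longer than [b]. *)
have [W [g [uW bE]]] := unimodular_multiple_of_row b.
exists W => // v v0.
have h : inf E <= N (toR R v) by apply: ge_inf; [exists c|exists v].
apply: (@le_trans _ _ (N (toR R b))); last by lra.
rewrite bE map_mxZ norm_onZ // ler_peMl ?norm_on_ge0 ?int_norm_ge1 //.
by apply: contra_neq b0 => g0; rewrite bE g0 scale0r.
Qed.

Section QuotientNorm.
Variables (R : realType) (d : nat) (N : 'rV[R]_(1 + d) -> R).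
Hypothesis hN : norm_on N.

Definition quot_norm (y : 'rV[R]_d) : R :=
  inf [set N (row_mx t y) | t in [set: 'rV[R]_1]].

Lemma quot_norm_le t y : quot_norm y <= N (row_mx t y).
Proof.
apply: ge_inf; last by exists t.
by exists 0 => _ [s _ <-]; exact: norm_on_ge0.
Qed.

Lemma quot_norm_glb y r : (forall t, r <= N (row_mx t y)) -> r <= quot_norm y.
Proof.
move=> h; apply: lb_le_inf => [|_ [t _ <-]//].
by exists (N (row_mx 0 y)), 0.
Qed.

Lemma quot_norm_on : norm_on quot_norm.
Proof.
split.
- move=> x y; rewrite -lerBlDr; apply: quot_norm_glb => t.
  rewrite lerBlDr -lerBlDl; apply: quot_norm_glb => s.
  rewrite lerBlDl; apply: le_trans (quot_norm_le (t + s) _) _.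
  by rewrite -add_row_mx norm_onD.
- move=> a x; have h t : quot_norm (a *: x) <= `|a| * N (row_mx t x).
    rewrite -norm_onZ // scale_row_mx; exact: quot_norm_le.
  have [a0|a0] := eqVneq a 0.
    by have := h 0; rewrite a0 normr0 !mul0r.
  rewrite -ler_pdivrMl ?normr_gt0 //; apply: quot_norm_glb => t.
  by rewrite ler_pdivrMl ?normr_gt0.
have [_ _ [c c0 hc]] := hN; exists c => // x i.
apply: quot_norm_glb => t.
by have := hc (row_mx t x) (rshift 1 i); rewrite row_mxEr.
Qed.

(** The factor 2 stands in for attainment of the infimum; it leaves room because the quotient norm
    is positive at [y]. *)
Lemma quot_norm_adherent y : y != 0 ->
  exists t : R, N (row_mx t%:M y) <= 2 * quot_norm y.
Proof.
move=> y0; have q0 := norm_on_gt0 quot_norm_on y0.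
have [||_ [t _ <-] ht] :=
  @inf_adherent R [set N (row_mx t y) | t in [set: 'rV[R]_1]] (quot_norm y).
- by [].
- split; first by exists (N (row_mx 0 y)), 0.
  by exists 0 => _ [s _ <-]; exact: norm_on_ge0.
exists (t 0 0); rewrite -mx11_scalar mulr2n mulrDl mul1r; exact: ltW.
Qed.

End QuotientNorm.
Lemma nearest_int (R : realType) (t : R) : exists z : int, `|z%:~R - t| <= 1 / 2.
Proof.
exists (Num.floor (t + 1 / 2)).
have := floor_le (t + 1 / 2); have := floorD1_gt (t + 1 / 2).
by rewrite intrD ler_norml => h1 h2; apply/andP; split; lra.
Qed.

(** Let q be the quotient norm of [y]. A real lift of norm at most 2q is rounded to an integer lift
    v, which adds at most N(e)/2, hence at most 3/4 N(v). So N(v) <= 8q and N(e) <= 12q. *)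
Lemma quot_norm_lift (R : realType) d (N : 'rV[R]_(1 + d) -> R)
    (e := row_mx 1%:M 0 : 'rV[R]_(1 + d)) (y : 'rV[int]_d) :
  norm_on N -> (forall v, v != 0 -> N e <= 3 / 2 * N (toR R v)) -> y != 0 ->
  exists2 z : int, N (toR R (row_mx z%:M y)) <= 8 * quot_norm N (toR R y) &
                   N e <= 12 * quot_norm N (toR R y).
Proof.
move=> hN he y0; have y0' : toR R y != 0.
  have /rV0Pn [i yi] := y0; apply/rV0Pn; exists i.
  by rewrite mxE intr_eq0.
have [t ht] := quot_norm_adherent hN y0'.
have [z hz] := nearest_int t.
have h1 : N (toR R (row_mx z%:M y)) <= 2 * quot_norm N (toR R y) + 1 / 2 * N e.
  have -> : toR R (row_mx z%:M y) = row_mx t%:M (toR R y) + (z%:~R - t) *: e.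
    rewrite /e scale_row_mx add_row_mx scaler0 addr0 scale_scalar_mx mulr1.
    by rewrite -raddfD addrC subrK map_row_mx map_scalar_mx.
  apply: le_trans (norm_onD hN _ _) _; rewrite norm_onZ // lerD //.
  by rewrite ler_wpM2r ?norm_on_ge0.
have h2 : N e <= 3 / 2 * N (toR R (row_mx z%:M y)).
  apply: he; apply: contra_neq y0 => h0.
  by rewrite -[y](row_mxKr z%:M) h0 linear0.
by exists z; lra.
Qed.

(** [T] consists of [e] and of short integer lifts of the rows of [U]. All coordinates but the first
    are bounded in the quotient; the first is then read off from x_0 e = x T minus the combination
    of the lifts. Monotonicity costs a factor 8 between lifts and 12 from [e] to a lift. *)
Lemma reduced_basis_step (R : realType) d (C : R) (N : 'rV[R]_(1 + d) -> R)
    (e := row_mx 1%:M 0 : 'rV[R]_(1 + d)) (U : 'M[int]_d) :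
  norm_on N -> (forall v, v != 0 -> N e <= 3 / 2 * N (toR R v)) ->
  1 <= C -> U \in unitmx ->
  (forall (x : 'rV_d) i, `|x 0 i| * quot_norm N (toR R (row i U))
               <= C * quot_norm N (x *m toR R U)) ->
  (forall i j : 'I_d, (i <= j)%N ->
     quot_norm N (toR R (row i U)) <= C * quot_norm N (toR R (row j U))) ->
  exists T : 'M[int]_(1 + d), [/\ T \in unitmx,
    forall (x : 'rV_(1 + d)) i, `|x 0 i| * N (toR R (row i T))
                <= (12 * C * d.+1%:R) * N (x *m toR R T) &
    forall i j : 'I_(1 + d), (i <= j)%N ->
      N (toR R (row i T)) <= (12 * C * d.+1%:R) * N (toR R (row j T))].
Proof.
move=> hN he C1 uU hU hmono; pose Q := quot_norm N.
have rowU i : row i U != 0.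
  apply: contraL uU => /eqP r0; rewrite unitmxE (expand_det_row U i).
  rewrite big1 ?unitr0 // => j _; have /rowP/(_ j) := r0.
  by rewrite !mxE => ->; rewrite mul0r.
have /fin_all_exists [tau htau] : forall i : 'I_d, exists z : int,
    N (toR R (row_mx z%:M (row i U))) <= 8 * Q (toR R (row i U)) /\
    N e <= 12 * Q (toR R (row i U)).
  by move=> i; have [z] := quot_norm_lift hN he (rowU i); exists z.
pose T : 'M[int]_(1 + d) := block_mx 1%:M 0 (\col_i tau i) U.
have rT0 : toR R (row (lshift d 0) T) = e.
  rewrite /T /block_mx rowKu row_row_mx map_row_mx; congr row_mx.
    by apply/rowP => j; rewrite !mxE (ord1 j).
  by apply/rowP => j; rewrite !mxE.
have rT i : row (rshift 1 i) T = row_mx (tau i)%:M (row i U).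
  rewrite /T /block_mx rowKd row_row_mx; congr row_mx.
  by apply/rowP => j; rewrite !mxE (ord1 j).
have QC i : Q (toR R (row i U)) <= N (toR R (row (rshift 1 i) T)).
  by rewrite rT map_row_mx quot_norm_le.
have xT x0 (x : 'rV[R]_d) : row_mx x0 x *m toR R T =
    row_mx (x0 + x *m toR R (\col_i tau i)) (x *m toR R U).
  by rewrite map_block_mx mul_row_block map_scalar_mx map_mx0 mulmx1 mulmx0 add0r.
have d1 : 0 <= d%:R :> R by [].
have dC : 12 * C <= 12 * C * d.+1%:R.
  by rewrite ler_peMr ?ler1n // mulr_ge0 // (le_trans _ C1).
have hr x0 (x : 'rV[R]_d) i : `|x 0 i| * N (toR R (row (rshift 1 i) T)) <=
     8 * C * N (row_mx x0 x *m toR R T).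
  rewrite rT; apply: le_trans (ler_wpM2l _ (proj1 (htau i))) _ => //.
  rewrite mulrCA -mulrA ler_pM2l //; apply: le_trans (hU x i) _.
  by rewrite ler_pM2l ?(lt_le_trans _ C1) // xT quot_norm_le.
exists T; split.
- by rewrite unitmxE det_lblock det1 mul1r.
- move=> x; rewrite -[x]hsubmxK; set x0 := lsubmx x; set x' := rsubmx x => i0.
  case: (split_ordP i0) => j ->; last first.
    rewrite row_mxEr; apply: le_trans (hr x0 x' j) _.
    by rewrite ler_wpM2r ?norm_on_ge0 //; lra.
  rewrite row_mxEl (ord1 j) rT0 -norm_onZ //.
  have -> : x0 0 0 *: e = row_mx x0 x' *m toR R T +
     \sum_i (- x' 0 i) *: toR R (row (rshift 1 i) T).
    under eq_bigr => i _ do rewrite scaleNr rT map_row_mx scale_row_mx.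
    rewrite sumrN xT; apply/rowP => k; rewrite !mxE summxE.
    case: (split_ordP k) => l ->; rewrite ?(row_mxEl, row_mxEr) !mxE.
      rewrite (ord1 l) mulr1 -addrA [X in _ + X](_ : _ = 0) ?addr0 //.
      apply/eqP; rewrite subr_eq0; apply/eqP; apply: eq_bigr => i _.
      by rewrite row_mxEl !mxE.
    rewrite mulr0; apply/esym/eqP; rewrite subr_eq0; apply/eqP.
    by apply: eq_bigr => i _; rewrite row_mxEr !mxE.
  apply: le_trans (norm_onD hN _ _) _.
  apply: le_trans (lerD (lexx _) (norm_on_sum hN _)) _.
  set M := N (row_mx x0 x' *m _).
  apply: (@le_trans _ _ (M + \sum_(i < d) 8 * C * M)).
    by rewrite lerD2l ler_sum // => k _; rewrite norm_onZ // normrN; exact: hr.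
  rewrite sumr_const card_ord -[(_ * M) *+ _]mulr_natr.
  have M0 : 0 <= M by exact: norm_on_ge0.
  have CM : M <= C * M by rewrite ler_peMl.
  have CMd : 0 <= C * M * d%:R by rewrite !mulr_ge0 // (le_trans _ C1).
  rewrite -natr1; lra.
have C0 : 0 <= C by rewrite (le_trans _ C1).
move=> i j; case: (split_ordP i) (split_ordP j) => i' -> [] j' -> //= lij.
- by rewrite (ord1 i') (ord1 j') ler_peMl ?norm_on_ge0 //; lra.
- rewrite (ord1 i') rT0; have [_ h] := htau j'.
  apply: le_trans h _; apply: ler_pM; rewrite ?(norm_on_ge0 (quot_norm_on hN)) //.
  by lra.
- by move: lij; rewrite (ord1 j').
rewrite rT; apply: le_trans (proj1 (htau i')) _.
apply: le_trans (ler_wpM2l _ (hmono _ _ (_ : (i' <= j')%N))) _ => //.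
rewrite mulrA; apply: ler_pM; rewrite ?(norm_on_ge0 (quot_norm_on hN)) //; lra.
Qed.

(** Substituting [W] turns the nearly shortest vector into the first unit vector, to which
    [reduced_basis_step] applies. *)
Lemma reduced_basis (R : realType) d : exists2 C : R, 1 <= C &
  forall N : 'rV[R]_d -> R, norm_on N -> exists U : 'M[int]_d,
  [/\ U \in unitmx,
    forall (x : 'rV_d) i, `|x 0 i| * N (toR R (row i U)) <= C * N (x *m toR R U) &
    forall i j : 'I_d, (i <= j)%N ->
      N (toR R (row i U)) <= C * N (toR R (row j U))].
Proof.
elim: d => [|d [C C1 IH]].
  by exists 1 => // N _; exists 1%:M; split=> [|x []|[]] //; exact: unitmx1.
exists (12 * C * d.+1%:R).
  by rewrite (@le_trans _ _ (12 * C)) ?ler_peMr ?ler1n //; lra.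
move=> N hN; have [W uW hW] := near_shortest hN.
have uWR := toR_unitmx R uW.
have hM : norm_on (fun x => N (x *m toR R W)).
  by apply: norm_on_comp => //; rewrite row_free_unit.
have [U [uU hU hmono]] := IH _ (quot_norm_on hM).
have [|T [uT hT hTmono]] := reduced_basis_step hM _ C1 uU hU hmono.
  move=> v v0; have -> : row_mx 1%:M 0 = toR R (delta_mx 0 0) :> 'rV_(1 + d).
    apply/rowP => k; case: (split_ordP k) => l ->.
      by rewrite row_mxEl !mxE (ord1 l).
    by rewrite row_mxEr !mxE.
  rewrite -!map_mxM -rowE; apply: hW.
  by apply: contra_neq v0 => h; rewrite -[v](mulmxK uW) h mul0mx.
exists (T *m W); split.
- by rewrite unitmx_mul uT.
- by move=> x i; have := hT x i; rewrite row_mul !map_mxM mulmxA.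
- by move=> i j lij; have := hTmono i j lij; rewrite !row_mul !map_mxM.
Qed.
(** * Hyperplane sections of a box *)

Definition box d (n : 'I_d -> nat) : seq 'rV[int]_d :=
  [seq \row_i ((f i : nat)%:Z - (n i)%:Z) |
     f : {dffun forall i : 'I_d, 'I_(2 * n i).+1}].

Lemma mem_box d (n : 'I_d -> nat) (x : 'rV[int]_d) :
  reflect (forall i, (`|x 0%R i| <= n i)%N) (x \in box n).
Proof.
apply: (iffP mapP) => [[f _ ->] i|h].
  by rewrite mxE; have /= := ltn_ord (f i); set a := nat_of_ord _; lia.
have hi i : (`|(x 0 i + (n i)%:Z)%R| < (2 * n i).+1)%N by have := h i; lia.
exists [ffun i => Ordinal (hi i)]; first by rewrite mem_enum.
by apply/rowP => i; rewrite !mxE ffunE /=; have := h i; lia.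
Qed.

Lemma uniq_box d (n : 'I_d -> nat) : uniq (box n).
Proof.
rewrite map_inj_uniq ?enum_uniq // => f g /rowP h.
apply/ffunP => i; apply: val_inj; have := h i; rewrite !mxE /=; lia.
Qed.

Lemma size_box d (n : 'I_d -> nat) : size (box n) = (\prod_i (2 * n i).+1)%N.
Proof.
rewrite size_map -cardE card_dep_ffun foldrE big_map big_enum /=.
by apply: eq_bigr => i _; rewrite card_ord.
Qed.

Lemma size_box_le d c (n m : 'I_d -> nat) :
  (forall i, (2 * n i).+1 <= c * m i)%N ->
  (size (box n) <= c ^ d * \prod_i m i)%N.
Proof.
move=> h; rewrite size_box; apply: leq_trans (leq_prod _) _; first by move=> i _; exact: h.
by rewrite big_split /= prod_nat_const card_ord.
Qed.

Definition dotz d (x z : 'rV[int]_d) : int := \sum_i x 0 i * z 0 i.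

Lemma dotzD d (x y z : 'rV[int]_d) : dotz (x + y) z = dotz x z + dotz y z.
Proof. by rewrite /dotz -big_split; apply: eq_bigr => i _; rewrite mxE mulrDl. Qed.

Lemma dotzZ d a (x z : 'rV[int]_d) : dotz (a *: x) z = a * dotz x z.
Proof. by rewrite /dotz mulr_sumr; apply: eq_bigr => i _; rewrite mxE mulrA. Qed.

Lemma dotz_delta d i (z : 'rV[int]_d) : dotz (delta_mx 0 i) z = z 0 i.
Proof.
rewrite /dotz (bigD1 i) //= mxE !eqxx mul1r big1 ?addr0 // => j ji.
by rewrite mxE (negPf ji) andbF mul0r.
Qed.

(** Coprimality of the coordinates in Bezout form: multiples of [u] realize every value of
    [dotz _ z]. *)
Definition primitive d (z : 'rV[int]_d) : bool := `[< exists u, dotz u z = 1 >].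

Definition slice d (n : 'I_d -> nat) (z : 'rV[int]_d) :=
  [seq x <- box n | dotz x z == 0].

(* The translates of the slice by a residue system modulo [z 0 i] and by
   multiples of the [i]th unit vector are disjoint, because [dotz _ z] separates
   them; all of them lie in a dilate of the box. *)
Lemma size_slice d (n : 'I_d -> nat) (z : 'rV[int]_d) i E :
  (forall j, 0 < n j)%N -> (0 < E)%N -> primitive z -> z 0 i != 0 ->
  (forall j, j != i -> `|z 0%R i| <= E * n j)%N ->
  (size (slice n z) * (`|z 0%R i| * n i) <= (2 * E + 3) ^ d * \prod_j n j)%N.
Proof.
move=> n0 E0 /asboolP [u uz] zi hz.
(* The product of [c *: u] with [z] is [c]. Clearing coordinate [i] and reducing the others modulo
   [z 0 i] keeps this congruence and makes the vector small. *)
pose y (c : nat) : 'rV[int]_d :=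
  \row_j (if j == i then 0 else (c%:Z * u 0%R j %% z 0%R i)%Z).
have yc c : (z 0%R i %| (dotz (y c) z - c%:Z)%R)%Z.
  have -> : dotz (y c) z - c%:Z = \sum_j (y c 0 j - c%:Z * u 0 j) * z 0 j.
    rewrite -[c%:Z in LHS]mulr1 -uz /dotz mulr_sumr -sumrB.
    by apply: eq_bigr => j _; rewrite mulrBl mulrA.
  apply: rpred_sum => j _.
  rewrite mxE; case: eqP => [->|_]; first by rewrite dvdz_mull.
  apply: dvdz_mulr; rewrite {2}(divz_eq (c%:Z * u 0 j) (z 0 i)).
  by rewrite opprD addrCA subrr addr0 rpredN dvdz_mull.
pose F x (cb : 'I_`|z 0%R i| * 'I_(n i)) : 'rV[int]_d :=
  x + y cb.1 + (cb.2 : nat)%:Z *: delta_mx 0 i.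
have szF : size [seq F x cb | x <- slice n z, cb <- enum {: 'I_`|z 0%R i| * 'I_(n i)}]
    = (size (slice n z) * (`|z 0%R i| * n i))%N.
  by rewrite size_allpairs -cardE card_prod !card_ord.
(* The translates have coordinates at most (1 + E) n_j, and 2 (1 + E) n_j + 1 <= (2 E + 3) n_j. *)
rewrite -szF; apply: leq_trans (@size_box_le _ (2 * E + 3) (fun j => (1 + E) * n j)%N n _).
  apply: uniq_leq_size.
    apply: allpairs_uniq; rewrite ?enum_uniq ?filter_uniq ?uniq_box //.
    move=> p q /allpairsP[[x [c b]] [/= hx _ ->]].
    move=> /allpairsP[[x' [c' b']] [/= hx' _ ->]] /= eF.
    move: hx hx'; rewrite !mem_filter => /andP [/eqP hx _] /andP [/eqP hx' _].
    have := congr1 (@dotz d ^~ z) eF.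
    rewrite /F /= !dotzD !dotzZ !dotz_delta hx hx' !add0r => ed.
    have ec : c = c'.
      apply: val_inj; apply/eqP; rewrite -eqz_nat; apply/eqP.
      have : (c%:Z = c'%:Z %[mod z 0%R i])%Z.
        apply/eqP; rewrite eqz_mod_dvd.
        have -> : c%:Z - c'%:Z = dotz (y c') z - c'%:Z - (dotz (y c) z - c%:Z)
                                 + (b'%:Z - b%:Z) * z 0 i.
          by rewrite mulrBl; lia.
        by apply: rpredD; [exact: rpredB|exact: dvdz_mull].
      by rewrite -!(modz_abs _ (z 0 i)) !modz_small //= ?ltz_nat ?ltn_ord // => -[].
    rewrite ec in ed eF *.
    have eb : b = b'.
      by apply: val_inj; move/addrI/(mulIf zi): ed => [].
    by rewrite eb in eF *; move/addIr/addIr: eF => ->.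
  move=> v /allpairsP[[x [c b]] [/= + _ ->]].
  rewrite mem_filter => /andP [_ /mem_box hx].
  apply/mem_box => j; rewrite !mxE eqxx /=; have := hx j.
  case: eqP => [->|/eqP ji].
    have := ltn_ord b; have := n0 i; rewrite mulr1 addr0; nia.
  have h1 := modz_ge0 (c%:Z * u 0 j) zi.
  have := ltz_mod (c%:Z * u 0 j) zi; have := hz j ji; rewrite mulr0 addr0; lia.
by move=> j; have := n0 j; nia.
Qed.
Lemma primitive_part d (z : 'rV[int]_d) : z != 0 ->
  exists z0 : 'rV[int]_d, exists2 g : int, z = g *: z0 & primitive z0.
Proof.
case: d z => [|d] z z0; first by case/rV0Pn: z0 => -[].
have [W [g [uW ->]]] := unimodular_multiple_of_row z.
exists (row 0 W), g => //; apply/asboolP; exists (col 0 (invmx W))^T.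
have /matrixP/(_ 0 0) := mulmxV uW; rewrite !mxE eqxx mulr1n => <-.
by apply: eq_bigr => j _; rewrite !mxE mulrC.
Qed.

Lemma exp0n_leq1 d : (0 ^ d <= 1)%N.
Proof. by case: d => // d; rewrite exp0n. Qed.

Lemma dotzC d (x z : 'rV[int]_d) : dotz x z = dotz z x.
Proof. by apply: eq_bigr => i _; rewrite mulrC. Qed.

Lemma normz_sum_le d (F : 'I_d -> int) r :
  (forall i, (`|F i| <= r)%N) -> `|\sum_i F i| <= (d * r)%N%:Z.
Proof.
move=> h; apply: le_trans (ler_norm_sum _ _ _) _.
apply: le_trans (ler_sum _ (_ : forall i, true -> `|F i| <= r%:Z)) _.
  by move=> i _; have := h i; lia.
by rewrite sumr_const card_ord -mulr_natl; lia.
Qed.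

(** Pigeonhole: with V = prod n_i, there are more than r^(d+1) / V vectors f with 0 <= f_i <= r /
    n_i, while x.f takes at most 2(d+1)r + 1 values. The difference of two vectors with equal
    products is orthogonal to [x], and its primitive part is no larger. *)
Lemma orthogonal_in_box d (n : 'I_d.+1 -> nat) r (x : 'rV[int]_d.+1) :
  (forall i, 0 < n i)%N -> ((2 * d.+1).+1 * \prod_i n i <= r ^ d)%N ->
  x \in box n ->
  exists z, [/\ z \in box (fun i => r %/ n i)%N, primitive z & dotz x z = 0].
Proof.
move=> n0 hr /mem_box hx; pose m i := (r %/ n i)%N.
have V0 : (0 < \prod_i n i)%N by rewrite prodn_gt0.
(* For r = 0 the power r^d is at most 1, the value 1 occurring at d = 0, which is still below the
   left side of [hr]. *)
have r0 : (0 < r)%N.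
  rewrite lt0n; apply: contraL hr => /eqP ->; rewrite -ltnNge.
  apply: (@leq_ltn_trans 1); first by rewrite exp0n_leq1.
  exact: leq_trans (leq_pmulr _ V0).
pose T := {dffun forall i : 'I_d.+1, 'I_(m i).+1}.
pose s (f : T) : int := \sum_i x 0 i * (f i : nat)%:Z.
have sle (f : T) : `|s f| <= (d.+1 * r)%N%:Z.
  apply: normz_sum_le => i; rewrite abszM absz_nat.
  apply: leq_trans (leq_mul (hx i) (_ : f i <= m i)%N) _; first by rewrite -ltnS.
  by rewrite mulnC leq_trunc_div.
pose g (f : T) : 'I_(2 * (d.+1 * r)).+1 := inord `|(s f + (d.+1 * r)%N%:Z)%R|%N.
have [inj_g|] := boolP (injectiveb g).
  have := leq_card g (injectiveP _ inj_g); rewrite card_dep_ffun card_ord foldrE big_map big_enum /=.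
  under eq_bigr => i _ do rewrite card_ord.
  have h : (r.+1 ^ d.+1 <= (\prod_i (m i).+1) * \prod_i n i)%N.
    rewrite -big_split /= -[d.+1 in X in (X <= _)%N]card_ord -prod_nat_const.
    by apply: leq_prod => i _; exact: ltn_ceil.
  have h2 : (r ^ d.+1 < r.+1 ^ d.+1)%N by rewrite ltn_exp2r.
  rewrite expnS in h2; move: h h2 hr V0.
  set P := (\prod_i _)%N; set V := (\prod_i n i)%N; set X := (r.+1 ^ _)%N; set Y := (r ^ d)%N.
  move=> h h2 hr V0 hP.
  have h3 : (P * V <= (2 * (d.+1 * r)).+1 * V)%N by rewrite leq_mul2r hP orbT.
  have h4 : (r * ((2 * d.+1).+1 * V) <= r * Y)%N by rewrite leq_mul2l hr orbT.
  have h5 : ((2 * (d.+1 * r)).+1 * V <= r * ((2 * d.+1).+1 * V))%N by nia.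
  lia.
move=> /injectivePn [f [f' ff' egf]].
have es : s f = s f'.
  have := congr1 val egf; rewrite /= !inordK; have := sle f; have := sle f'; lia.
pose z : 'rV[int]_d.+1 := \row_i ((f i : nat)%:Z - (f' i : nat)%:Z).
have z0 : z != 0.
  apply: contra_neq ff' => /rowP h; apply/ffunP => i; apply: val_inj.
  by have := h i; rewrite !mxE /=; lia.
have zx : dotz x z = 0.
  rewrite -[RHS](subrr (s f)) {2}es /dotz -sumrB.
  by apply: eq_bigr => i _; rewrite mxE mulrBr.
have [w [k zE pw]] := primitive_part z0.
have k0 : k != 0 by apply: contra_neq z0 => k0; rewrite zE k0 scale0r.
exists w; split=> //.
  apply/mem_box => i; apply: (@leq_trans `|z 0%R i|%N).
    rewrite zE mxE abszM leq_pmull //; lia.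
  rewrite mxE; have /= := ltn_ord (f i); have /= := ltn_ord (f' i).
  rewrite -/(m i); lia.
by move/eqP: zx; rewrite dotzC zE dotzZ mulf_eq0 (negPf k0) /= dotzC => /eqP.
Qed.

Definition hyperplanes d (n : 'I_d -> nat) r : seq 'rV[int]_d :=
  [seq z <- box (fun i => r %/ n i)%N | primitive z].

(** As n_i <= r, each factor 2 (r / n_i) + 1 is at most 3 r / n_i, so the product is at most
    (3r)^(d+1) / V. *)
Lemma size_hyperplanes d (n : 'I_d.+1 -> nat) r A :
  (forall i, 0 < n i <= r)%N -> (r ^ d <= A * \prod_i n i)%N ->
  (size (hyperplanes n r) <= 3 ^ d.+1 * A * r)%N.
Proof.
move=> hn hr; rewrite size_filter; apply: leq_trans (count_size _ _) _.
rewrite size_box.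
have V0 : (0 < \prod_i n i)%N by rewrite prodn_gt0 // => i; case/andP: (hn i).
rewrite -(leq_pmul2r V0) -big_split /=.
apply: (@leq_trans ((3 * r) ^ d.+1)).
  rewrite -[d.+1 in X in (_ <= X)%N]card_ord -prod_nat_const.
  apply: leq_prod => i _; have := leq_trunc_div r (n i); have := hn i.
  by set q := (_ %/ _)%N; nia.
by rewrite expnMn -!mulnA leq_mul2l mulnCA [(r ^ _)%N]expnS leq_mul2l hr !orbT.
Qed.

(** * The sum of the slice sizes over all hyperplanes *)

Section SliceSum.
Variables (d : nat) (n : 'I_d.+1 -> nat) (r A : nat).
Hypotheses (hn : forall i, (0 < n i <= r)%N) (hr : (r ^ d <= A * \prod_i n i)%N).

Let m i := (r %/ n i)%N.
Let F := ((2 * A + 3) ^ d.+1)%N.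
Let V := (\prod_i n i)%N.

Let n0 i : (0 < n i)%N. Proof. by case/andP: (hn i). Qed.
Let nr i : (n i <= r)%N. Proof. by case/andP: (hn i). Qed.
Let r0 : (0 < r)%N. Proof. exact: leq_trans (n0 ord0) (nr ord0). Qed.
Let V0 : (0 < V)%N. Proof. exact: prodn_gt0. Qed.
Let A0 : (0 < A)%N.
Proof. by move: hr; rewrite -/V; case: A => // h; have := expn_gt0 r d; rewrite r0 /=; lia. Qed.

(** The other d-1 sides are at most r, so r^d <= A V <= A n_i n_j r^(d-1). Hence |z_i| <= r / n_i
    implies |z_i| <= A n_j, as [size_slice] requires. *)
Lemma box_pair_ge i j : i != j -> (r <= A * n i * n j)%N.
Proof.
move=> ij; set P := (\prod_(l | (l != i) && (l != j)) r)%N.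
have P0 : (0 < P)%N by apply: prodn_gt0.
have rE : (r ^ d.+1 = r * (r * P))%N.
  rewrite -[d.+1]card_ord -prod_nat_const (bigD1 i) //= (bigD1 j) //=.
  by rewrite eq_sym.
have VE : (V <= n i * (n j * P))%N.
  rewrite /V (bigD1 i) //= (bigD1 j) //=; last by rewrite eq_sym.
  by rewrite !leq_mul2l leq_prod ?orbT // => l _.
have h : (r * (r * P) <= r * (A * (n i * (n j * P))))%N.
  by rewrite -rE expnS leq_mul2l (leq_trans hr) ?orbT // leq_mul2l VE orbT.
by move: h; rewrite leq_pmul2l // !mulnA leq_pmul2r.
Qed.

Lemma hyperplane_slice_le z i : z \in hyperplanes n r -> z 0 i != 0 ->
  (size (slice n z) * (`|z 0%R i| * n i) <= F * V)%N.
Proof.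
rewrite mem_filter => /andP [pz /mem_box hz] zi.
apply: size_slice => // j ji; rewrite -(leq_pmul2r (n0 i)).
apply: (@leq_trans r).
  by apply: leq_trans (leq_trunc_div r (n i)); rewrite leq_mul2r hz orbT.
by rewrite mulnAC box_pair_ge // eq_sym.
Qed.

(** The slice of such a [z] is bounded through [i], which has the larger weight a n_i; in return z_j
    is confined to the range a n_i / n_j instead of r / n_j. *)
Let cls i j (a : nat) (z : 'rV[int]_d.+1) :=
  [&& `|z 0%R i|%N == a, z 0 j != 0 & (`|z 0%R j| * n j <= a * n i)%N].
Let K i j a := seq.filter (cls i j a) (box m).

(** There are at most 3 choices for the sign of z_i, at most 3 a n_i / n_j for z_j and at most 3 r /
    n_l for every other z_l. The extra factor [r] on the left avoids the exponent d-1. *)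
Lemma size_hyperplane_class i j a : i != j -> (a <= m i)%N ->
  (size (K i j a) * (\prod_(l | l != i) n l) * r <= 3 ^ d.+1 * (a * n i) * r ^ d)%N.
Proof.
(* An empty class is trivial. A member has z_j nonzero, so n_j <= a n_i, which absorbs the + 1 in
   the number of choices for z_j. *)
move=> ij ami; case EK: (K i j a) => [|z0 s] //.
have : z0 \in K i j a by rewrite EK mem_head.
rewrite -EK => {EK s}; rewrite mem_filter => /andP [/and3P [_ z0j z0n] _].
have nj : (n j <= a * n i)%N by apply: leq_trans z0n; rewrite leq_pmull // absz_gt0.
pose m' l := if l == i then 1%N else if l == j then (a * n i %/ n j)%N else m l.
have Kle : (size (K i j a) <= size (box m'))%N.
  (* Since |z_i| = a is fixed, the sign of z_i determines it. *)
  pose f (z : 'rV[int]_d.+1) : 'rV[int]_d.+1 := \row_l (if l == i then sgz (z 0 l) else z 0 l).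
  rewrite -(size_map f); apply: uniq_leq_size.
    rewrite map_inj_in_uniq ?filter_uniq ?uniq_box // => z z'.
    rewrite !mem_filter => /andP [/and3P [/eqP zi _ _] _] /andP [/and3P [/eqP zi' _ _] _].
    move=> /rowP h; apply/rowP => l; have := h l; rewrite !mxE.
    by case: eqP => // -> e; rewrite [z 0 i]intEsg [z' 0 i]intEsg e zi zi'.
  move=> _ /mapP [z + ->]; rewrite mem_filter => /andP [/and3P [_ _ zj] /mem_box hz].
  apply/mem_box => l; rewrite mxE /m'; case: eqP => [_|_].
    by case: sgzP.
  by case: eqP => [->|_] //; rewrite leq_divRL.
pose P := (\prod_(l | (l != i) && (l != j)) (3 * r))%N.
have PE : ((3 * r) * ((3 * r) * P) = (3 * r) ^ d.+1)%N.
  rewrite -[d.+1]card_ord -prod_nat_const (bigD1 i) //= (bigD1 j) //=.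
  by rewrite eq_sym.
have h : (size (box m') * \prod_(l | l != i) n l <= 3 * (3 * (a * n i) * P))%N.
  rewrite size_box (bigD1 i) //= {1}/m' eqxx -mulnA leq_mul2l /= -big_split /=.
  rewrite (bigD1 j) /=; last by rewrite eq_sym.
  apply: leq_mul.
    rewrite /m' eq_sym (negPf ij) eqxx.
    have := leq_trunc_div (a * n i) (n j); set q := (_ %/ n j)%N; nia.
  apply: leq_prod => l /andP [li lj]; rewrite /m' (negPf li) (negPf lj).
  have := leq_trunc_div r (n l); have := nr l; rewrite -/(m l); nia.
rewrite -(leq_pmul2r r0).
apply: (@leq_trans (3 * (3 * (a * n i) * P) * r * r)).
  by rewrite !leq_mul2r (leq_trans _ h) ?orbT // leq_mul2r Kle orbT.
rewrite -[X in (_ <= X)%N]mulnA -expnSr.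
have -> : (3 * (3 * (a * n i) * P) * r * r = (a * n i) * ((3 * r) * ((3 * r) * P)))%N by ring.
by rewrite PE expnMn mulnA [(_ * 3 ^ _)%N]mulnC.
Qed.

(** In a primitive vector a coordinate of absolute value above 1 is not the only nonzero one. Of two
    nonzero coordinates, [i] is the one with the larger weight. *)
Lemma hyperplane_classP z : z \in hyperplanes n r -> z \notin box (fun=> 1%N) ->
  exists i j, [/\ i != j, z 0 i != 0, z 0 j != 0 &
                  (`|z 0%R j| * n j <= `|z 0%R i| * n i)%N].
Proof.
rewrite mem_filter => /andP [/asboolP [u uz] _] hz.
have [i zi] : exists i, (1 < `|z 0%R i|)%N.
  apply/existsP; move: hz; apply: contraR => /existsPn h.
  by apply/mem_box => i; rewrite leqNgt h.
have [j ji zj] : exists2 j, j != i & z 0 j != 0.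
  apply/exists_inP; move: zi; apply: contraTT => /exists_inPn h.
  move: uz; rewrite /dotz (bigD1 i) //= big1 ?addr0 => [|j ji].
    move=> e; have := congr1 absz e; rewrite abszM => /eqP.
    by rewrite muln_eq1 => /andP [_ /eqP ->].
  by have /negPn/eqP -> := h j ji; rewrite mulr0.
have zi0 : z 0 i != 0 by lia.
case: (leqP (`|z 0%R j| * n j) (`|z 0%R i| * n i)) => [h|/ltnW h].
  by exists i, j; rewrite eq_sym.
by exists j, i.
Qed.

(** At most 3^(d+1) normals have all entries in {-1, 0, 1}; each is charged the whole box. Any other
    normal lies in a class (i, j, a), where slices have at most F V / (a n_i) points and the class
    has O(a n_i r^(d-1) / prod_(l != i) n_l) members. The product O(n_i r^(d-1)) does not involve a,
    so the at most r / n_i values of a contribute O(r^d) = O(V) for each pair (i, j). *)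
Lemma sum_slices : (\sum_(z <- hyperplanes n r) size (slice n z) <=
  (9 ^ d.+1 + d.+1 ^ 2 * (3 ^ d.+1 * F * A)) * V)%N.
Proof.
rewrite (bigID (fun z => z \in box (fun=> 1%N))) /= mulnDl; apply: leq_add.
  apply: (@leq_trans (\sum_(z <- hyperplanes n r | z \in box (fun=> 1%N)) size (box n))%N).
    by apply: leq_sum => z _; rewrite size_filter count_size.
  rewrite big_const_seq iter_addn_0 mulnC -[(9 ^ _)%N]/((3 * 3) ^ _)%N expnMn -mulnA.
  apply: leq_mul; last by apply: size_box_le => i; have := n0 i; lia.
  rewrite -size_filter; apply: (@leq_trans (size (box (fun _ : 'I_d.+1 => 1%N)))).
    apply: uniq_leq_size; first by rewrite !filter_uniq // uniq_box.
    by move=> z; rewrite mem_filter => /andP [].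
  by rewrite size_box prod_nat_const card_ord.
pose W i a := ((F * V) %/ (a * n i))%N.
(* The value |z_i| is [a.+1], which runs from 1 to [m i]; each such [z] occurs in at least one
   class. *)
apply: (@leq_trans (\sum_(z <- hyperplanes n r)
   \sum_(p : 'I_d.+1 * 'I_d.+1 | p.1 != p.2) \sum_(a < m p.1)
      (if cls p.1 p.2 a.+1 z then W p.1 a.+1 else 0))%N).
  rewrite [X in (_ <= X)%N](bigID (fun z => z \in box (fun=> 1%N))) /=.
  apply: leq_trans (leq_addl _ _).
  rewrite big_seq_cond [X in (_ <= X)%N]big_seq_cond; apply: leq_sum => z /andP [hz hz1].
  have [i [j [ij zi zj zij]]] := hyperplane_classP hz hz1.
  rewrite (bigD1 (i, j)) //=; apply: leq_trans (leq_addr _ _).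
  have zi' : (0 < `|z 0%R i|)%N by rewrite absz_gt0.
  have am : (`|z 0%R i|.-1 < m i)%N.
    by move: hz; rewrite mem_filter prednK // => /andP [_ /mem_box].
  rewrite (bigD1 (Ordinal am)) //= /cls prednK // eqxx zj zij /=.
  apply: leq_trans (leq_addr _ _); rewrite /W leq_divRL ?muln_gt0 ?zi' ?n0 //.
  exact: hyperplane_slice_le.
rewrite exchange_big /=.
apply: (@leq_trans (\sum_(p : 'I_d.+1 * 'I_d.+1 | p.1 != p.2) 3 ^ d.+1 * F * r ^ d)%N).
  apply: leq_sum => -[i j] /= ij; rewrite exchange_big /=.
  rewrite -(leq_pmul2r r0) big_distrl /=.
  apply: (@leq_trans (\sum_(a < m i) 3 ^ d.+1 * F * r ^ d * n i)%N); last first.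
    by rewrite sum_nat_const card_ord mulnCA leq_mul2l leq_trunc_div orbT.
  apply: leq_sum => a _.
  rewrite -big_mkcond big_const_seq iter_addn_0.
  have cK : (count (cls i j a.+1) (hyperplanes n r) <= size (K i j a.+1))%N.
    by rewrite count_filter size_filter; apply: sub_count => z /andP [].
  pose P := (\prod_(l | l != i) n l)%N.
  have P0 : (0 < P)%N by apply: prodn_gt0.
  have h1 : (size (K i j a.+1) * P * r <= 3 ^ d.+1 * (a.+1 * n i) * r ^ d)%N.
    exact: size_hyperplane_class.
  have h2 : (W i a.+1 * (a.+1 * n i) <= F * (n i * P))%N.
    by apply: leq_trans (leq_trunc_div _ _) _; rewrite /V (bigD1 i).
  rewrite -(leq_pmul2r P0); apply: (@leq_trans (W i a.+1 * (size (K i j a.+1) * P * r))).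
    rewrite -!mulnA leq_mul2l [(r * P)%N]mulnC leq_mul2r cK !orbT //.
  apply: leq_trans (leq_mul (leqnn _) h1) _.
  have -> : (W i a.+1 * (3 ^ d.+1 * (a.+1 * n i) * r ^ d) =
             W i a.+1 * (a.+1 * n i) * (3 ^ d.+1 * r ^ d))%N by ring.
  apply: leq_trans (leq_mul h2 (leqnn _)) _.
  by apply: eq_leq; ring.
rewrite sum_nat_const -[X in (_ <= X)%N]mulnA; apply: leq_mul.
  by apply: leq_trans (max_card _) _; rewrite card_prod card_ord mulnn.
by rewrite -!mulnA !leq_mul2l hr !orbT.
Qed.
End SliceSum.
(** * Covering the integer points of a box *)

Definition covers_ints (R : realType) d k (s : seq 'M[R]_(k, d))
    (P : 'rV[int]_d -> Prop) : Prop :=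
  covers_by_subspaces s [set toR R x | x in P].

Lemma covers_intsP (R : realType) d k (s : seq 'M[R]_(k, d)) P :
  covers_ints s P <-> (forall U, U \in s -> row_free U) /\
    forall x, P x -> exists2 U, U \in s & (toR R x <= U)%MS.
Proof.
split=> -[h1 h2]; split=> // x Px; first by apply: h2; exists x.
by case: Px => y Py <-; exact: h2.
Qed.

Lemma covers_points (R : realType) d (t : seq 'rV[int]_d.+1) :
  exists2 s : seq 'M[R]_(1, d.+1), covers_ints s (fun x => x \in t) & size s = size t.
Proof.
(* The zero vector spans no line and is given an arbitrary one. *)
exists [seq (if x == 0 then delta_mx 0 0 else toR R x) | x <- t]; last by rewrite size_map.
apply/covers_intsP; split=> [U /mapP [x _ ->]|x xt].
  rewrite /row_free rank_rV; set v := (if _ then _ else _).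
  suff -> : v != 0 by [].
  rewrite /v; case: (x =P 0) => [_|/eqP /rV0Pn [i xi]]; apply/rV0Pn.
    by exists 0; rewrite mxE oner_eq0.
  by exists i; rewrite mxE intr_eq0.
exists (if x == 0 then delta_mx 0 0 else toR R x); first by apply/mapP; exists x.
by case: eqP => [->|_]; rewrite ?map_mx0 ?sub0mx.
Qed.

(** Each subspace is replaced by its preimage under the projection that forgets coordinate [i], with
    [E] the inclusion and [E^T] the projection. *)
Lemma covers_lift (R : realType) d k (i : 'I_d.+1) (n : 'I_d.+1 -> nat)
    (s : seq 'M[R]_(k, d)) :
  covers_ints s (fun x => x \in box (fun j => n (lift i j))) ->
  exists2 s' : seq 'M[R]_(k.+1, d.+1),
    covers_ints s' (fun x => x \in box n) & size s' = size s.
Proof.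
move=> /covers_intsP [hfree hs].
pose E : 'M[R]_(d, d.+1) := rowsub (lift i) 1%:M.
pose e : 'rV[R]_d.+1 := delta_mx 0 i.
have li b : (lift i b == i) = false by rewrite eq_sym (negPf (neq_lift _ _)).
have xET m (x : 'M[R]_(m, d.+1)) : x *m E^T = colsub (lift i) x.
  have -> : E^T = colsub (lift i) 1%:M.
    by apply/matrixP => a b; rewrite !mxE eq_sym.
  by rewrite mulmx_colsub mulmx1.
have EET : E *m E^T = 1%:M.
  by rewrite xET; apply/matrixP => a b; rewrite !mxE (inj_eq lift_inj).
have eET : e *m E^T = 0.
  by rewrite xET; apply/matrixP => a b; rewrite !mxE li andbF.
exists [seq (col_mx e (U *m E) : 'M[R]_(k.+1, d.+1)) | U : 'M[R]_(k, d) <- s]; last by rewrite size_map.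
apply/covers_intsP; split=> [U' /mapP [U Us ->]|x /mem_box hx].
  apply: (@inj_row_free _ (1 + k) _ (col_mx e (U *m E))) => v; rewrite -[v]hsubmxK mul_row_col => h.
  have v1 : rsubmx v = 0.
    have := congr1 (mulmx^~ E^T) h.
    rewrite mul0mx mulmxDl -!mulmxA eET mulmx0 add0r EET mulmx1 => /eqP.
    by rewrite mulmx_free_eq0 ?hfree // => /eqP.
  move: h; rewrite v1 mul0mx addr0 => /rowP/(_ i); rewrite !mxE big_ord1 !mxE !eqxx mulr1 => v0.
  rewrite (_ : lsubmx v = 0) ?row_mx0 //.
  by apply/rowP => j; rewrite (ord1 j) !mxE.
have [|U Us hU] := hs (colsub (lift i) x).
  by apply/mem_box => j; rewrite mxE.
exists (col_mx e (U *m E)); first by apply/mapP; exists U.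
have -> : toR R x = (x 0 i)%:~R *: e + colsub (lift i) (toR R x) *m E.
  apply/rowP => j; rewrite !mxE; case: (unliftP i j) => [l ->|->].
    rewrite li andbF mulr0 add0r (bigD1 l) //= !mxE eqxx mulr1.
    rewrite big1 ?addr0 // => a al; rewrite !mxE (inj_eq lift_inj) (negPf al) mulr0 //.
  rewrite !eqxx mulr1 big1 ?addr0 // => a _.
  by rewrite !mxE li mulr0.
apply: (@submx_trans _ _ _ _ _ _ (e + U *m E)%MS); last by rewrite addsmxE.
rewrite addmx_sub_adds ?scalemx_sub // submxMr //.
by rewrite -map_mxsub.
Qed.

(** Up to the factor [g], [dotz x z] is the first coordinate of [x *m W^T], so the rows after the
    first of the inverse of [W^T] form a basis of the orthogonal lattice. *)
Lemma hyperplane_lattice (R : realType) d (z : 'rV[int]_d.+1) : z != 0 ->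
  exists G : 'M[int]_(d, d.+1), [/\ row_free (toR R G),
    forall x, dotz x z = 0 -> exists y, x = y *m G &
    forall y, dotz (y *m G) z = 0].
Proof.
move=> z0; have [W [g [uW zE]]] := unimodular_multiple_of_row z.
have g0 : g != 0 by apply: contra_neq z0 => g0; rewrite zE g0 scale0r.
have dE x : dotz x z = g * (x *m W^T) 0 0.
  by rewrite dotzC zE dotzZ dotzC mxE; congr (_ * _); apply: eq_bigr => j _; rewrite !mxE.
have uWT : W^T \in unitmx by rewrite unitmx_tr.
pose Wi : 'M[int]_(1 + d, d.+1) := invmx W^T.
pose WT : 'M[int]_(d.+1, 1 + d) := W^T.
have WiWT : Wi *m WT = 1%:M by exact: mulVmx.
have rowWi (l : 'rV_1) (y : 'rV_d) :
    row_mx l y *m Wi = l *m usubmx Wi + y *m dsubmx Wi.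
  by rewrite -[in LHS](vsubmxK Wi) mul_row_col.
exists (dsubmx Wi); split.
- apply/row_freeP; exists (toR R (rsubmx WT)); rewrite -map_mxM.
  have : drsubmx (Wi *m WT) = 1%:M by rewrite WiWT scalar_mx_block block_mxKdr.
  rewrite -[Wi]vsubmxK -[WT]hsubmxK mul_col_row block_mxKdr vsubmxK hsubmxK => ->.
  by rewrite map_scalar_mx.
- move=> x /eqP; rewrite dE mulf_eq0 (negPf g0) /= => /eqP x0.
  exists (rsubmx (x *m WT)); have {1}-> : x = (x *m WT) *m Wi by rewrite mulmxK.
  rewrite -{1}[x *m WT]hsubmxK rowWi (_ : lsubmx (x *m WT) = 0) ?mul0mx ?add0r //.
  by apply/rowP => j; rewrite (ord1 j) [LHS]mxE [RHS]mxE -[RHS]x0; congr (_ _ _); apply: val_inj.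
move=> y; rewrite dE -[_ *m W^T]/(y *m dsubmx Wi *m WT).
have -> : y *m dsubmx Wi = row_mx 0 y *m Wi by rewrite rowWi mul0mx add0r.
by rewrite -mulmxA WiWT mulmx1 mxE; case: splitP => // j _; rewrite mxE mulr0.
Qed.

(** A weighted l1 norm: its unit ball meets the integer points inside the box, and the box lies in
    its ball of radius d. *)
Definition box_norm (R : realType) d (n : 'I_d -> nat) (x : 'rV[R]_d) : R :=
  \sum_i `|x 0 i| / (n i)%:R.

Lemma box_norm_on (R : realType) d (n : 'I_d -> nat) :
  (forall i, 0 < n i)%N -> norm_on (@box_norm R d n).
Proof.
move=> n0; split.
- move=> x y; rewrite -big_split ler_sum // => i _.
  by rewrite mxE /= -mulrDl ler_wpM2r ?invr_ge0 // ler_normD.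
- by move=> a x; rewrite mulr_sumr ler_sum // => i _; rewrite mxE normrM mulrA.
(* Every n_j is at least 1, so this product is a positive lower bound for each 1 / n_i. *)
exists (\prod_i (n i)%:R^-1); first by apply: prodr_gt0 => i _; rewrite invr_gt0 ltr0n.
move=> x i; rewrite /box_norm (bigD1 i) //= [X in _ <= X](bigD1 i) //=.
apply: (@le_trans _ _ (`|x 0 i| / (n i)%:R)).
  rewrite mulrAC [_^-1 * `|_|]mulrC ler_piMr // ?mulr_ge0 ?invr_ge0 //.
  by apply: prodr_ile1 => j _; rewrite invr_ge0 ler0n invf_le1 ?ler1n ?ltr0n ?n0.
by rewrite lerDl sumr_ge0 // => j _; rewrite mulr_ge0 ?invr_ge0.
Qed.

Lemma box_norm_le (R : realType) d (n : 'I_d -> nat) (x : 'rV[int]_d) :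
  (forall i, 0 < n i)%N -> x \in box n -> @box_norm R d n (toR R x) <= d%:R.
Proof.
move=> n0 /mem_box hx; rewrite -[d in d%:R]card_ord -sum1_card natr_sum.
apply: ler_sum => i _; rewrite ler_pdivrMr ?ltr0n // mul1r mxE.
by rewrite -intr_norm -natr_absz ler_nat.
Qed.

Lemma box_norm_mem (R : realType) d (n : 'I_d -> nat) (x : 'rV[int]_d) :
  (forall i, 0 < n i)%N -> @box_norm R d n (toR R x) <= 1 -> x \in box n.
Proof.
move=> n0 h; apply/mem_box => i.
rewrite -(ler_nat R) natr_absz intr_norm -[X in _ <= X]mul1r -ler_pdivrMr ?ltr0n //.
apply: le_trans h; rewrite /box_norm (bigD1 i) //= mxE lerDl.
by rewrite sumr_ge0 // => j _; rewrite mulr_ge0 ?invr_ge0.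
Qed.
Lemma row_free_neq0 (F : fieldType) m n (A : 'M[F]_(m, n)) i :
  row_free A -> row i A != 0.
Proof.
move=> /row_freeP [B AB]; apply/eqP => h; have := congr1 (row i) AB.
rewrite row_mul h mul0mx => /rowP/(_ i)/eqP.
by rewrite !mxE eqxx eq_sym oner_eq0.
Qed.

Lemma row_free_mul (F : fieldType) m n p (A : 'M[F]_(m, n)) (B : 'M[F]_(n, p)) :
  row_free A -> row_free B -> row_free (A *m B).
Proof. by move=> hA hB; rewrite /row_free mxrankMfree. Qed.

Lemma covers_map (R : realType) d e k (M : 'M[int]_(d, e)) (s : seq 'M[R]_(k, d))
    (P : 'rV[int]_d -> Prop) (Q : 'rV[int]_e -> Prop) :
  row_free (toR R M) -> covers_ints s P ->
  (forall x, Q x -> exists2 y, P y & x = y *m M) ->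
  exists2 s' : seq 'M[R]_(k, e), covers_ints s' Q & size s' = size s.
Proof.
move=> hM /covers_intsP [hfree hs] hQ.
exists [seq U *m toR R M | U : 'M[R]_(k, d) <- s]; last by rewrite size_map.
apply/covers_intsP; split=> [_ /mapP [U Us ->]|x /hQ [y Py ->]].
  by rewrite row_free_mul ?hfree.
have [U Us hU] := hs y Py; exists (U *m toR R M); first by apply/mapP; exists U.
by rewrite map_mxM submxMr.
Qed.

(** With u_i the rows of [U], the points with |w_i| <= 1 / (d N(u_i)) lie in the unit ball by the
    triangle inequality, and the box with sides C0 / N(u_i) is larger than theirs by a constant
    factor only. [f] and [t] allow counting in an ambient lattice. *)
Lemma size_box_norm_le (R : realType) d (C0 : R) : 0 <= C0 -> exists C : nat,
  forall (N : 'rV[R]_d -> R) (U : 'M[int]_d) (T : eqType)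
    (f : 'rV[int]_d -> T) (t : seq T),
  norm_on N -> injective f -> (forall w, N (toR R (w *m U)) <= 1 -> f w \in t) ->
  (\prod_i (Num.trunc (C0 / N (toR R (row i U)))).+1 <= C * size t)%N.
Proof.
move=> C00; pose c := (Num.trunc (C0 * d%:R)).+2.
exists (c ^ d)%N => N U T f t hN finj ft; pose Ni i := N (toR R (row i U)).
pose q i := Num.trunc (d%:R * Ni i)^-1.
apply: (@leq_trans (c ^ d * size (box q))).
  rewrite size_box -[X in (_ <= X ^ _ * _)%N]/c -[in X in (_ <= _ ^ X * _)%N](card_ord d).
  rewrite -prod_nat_const -big_split /=; apply: leq_prod => i _; rewrite -/(Ni i).
  have d0 : 0 < d%:R :> R by rewrite ltr0n; case: (d) i => // -[].
  (* If [N] vanishes on the row, the convention 0^-1 = 0 makes the factor on the left 1. *)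
  have [N0|] := ltrP 0 (Ni i); last first.
    move=> N0; have -> : Ni i = 0 by apply: le_anti; rewrite N0 norm_on_ge0.
    by rewrite invr0 mulr0 truncn0 muln_gt0.
  have hq : (d%:R * Ni i)^-1 < (q i).+1%:R by exact: truncnS_gt.
  have hc : C0 * d%:R < (Num.trunc (C0 * d%:R)).+1%:R by exact: truncnS_gt.
  have h : (Num.trunc (C0 / Ni i) <= (Num.trunc (C0 * d%:R)).+1 * (q i).+1)%N.
    rewrite truncn_le_nat -natr1 natrM ltr_pwDr //.
    have -> : C0 / Ni i = C0 * d%:R * (d%:R * Ni i)^-1.
      by rewrite invfM mulrA mulfK ?gt_eqF.
    by apply: ler_pM; rewrite ?mulr_ge0 ?invr_ge0 ?mulr_ge0 //; exact: ltW.
  by rewrite /c; move: h; set a := Num.trunc _; set b := (Num.trunc _).+1; nia.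
have ub : uniq (map f (box q)) by rewrite map_inj_uniq // uniq_box.
rewrite leq_mul2l -(size_map f) uniq_leq_size ?orbT //.
move=> _ /mapP [w /mem_box hw ->]; apply: ft.
have -> : toR R (w *m U) = \sum_i (w 0 i)%:~R *: toR R (row i U).
  rewrite map_mxM mulmx_sum_row; apply: eq_bigr => i _.
  by rewrite mxE map_row.
apply: le_trans (norm_on_sum hN _) _.
have [d0|d0] := posnP d.
  by rewrite big1 // => i; have := ltn_ord i; rewrite [X in (_ < X)%N]d0.
apply: (@le_trans _ _ (\sum_(i < d) d%:R^-1)).
  apply: ler_sum => i _; rewrite norm_onZ // -/(Ni i).
  have N0 : 0 <= Ni i by exact: norm_on_ge0.
  apply: (@le_trans _ _ ((d%:R * Ni i)^-1 * Ni i)).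
    rewrite ler_wpM2r // -intr_norm -natr_absz.
    apply: (@le_trans _ _ (q i)%:R); first by rewrite ler_nat.
    by rewrite truncn_le invr_ge0 mulr_ge0.
  have [->|Ni0] := eqVneq (Ni i) 0; first by rewrite mulr0 invr_ge0.
  by rewrite invfM mulfVK.
by rewrite sumr_const card_ord -[_ *+ d]mulr_natl divff // pnatr_eq0 -lt0n.
Qed.

(** In a reduced basis of the orthogonal lattice for the restricted box norm, the slice lies in a
    box of volume O(size of the slice), to which the hypothesis applies. Bounding by the actual size
    of the slice is what allows summation over [z]. *)
Lemma slice_cover (R : realType) d k C :
  (forall (n : 'I_d.+1 -> nat) rho, (forall i, 0 < n i)%N -> (0 < rho)%N ->
    exists2 s : seq 'M[R]_(k.+1, d.+1), covers_ints s (fun x => x \in box n) &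
      (size s * rho ^ k <= C * (\prod_i n i + rho ^ d))%N) ->
  exists C' : nat, forall (n : 'I_d.+2 -> nat) z rho,
    (forall i, 0 < n i)%N -> (0 < rho)%N -> z != 0 ->
    exists2 s : seq 'M[R]_(k.+1, d.+2), covers_ints s (fun x => x \in slice n z) &
      (size s * rho ^ k <= C' * (size (slice n z) + rho ^ d))%N.
Proof.
move=> IH; have [C1 C11 hC1] := reduced_basis R d.+1.
have C1d : 0 <= C1 * d.+2%:R by rewrite mulr_ge0 // (le_trans _ C11).
have [C2 hC2] := size_box_norm_le d.+1 C1d.
exists (C * C2.+1)%N => n z rho n0 rho0 z0.
have [G [Gfree Gz zG]] := hyperplane_lattice R z0.
have hM := norm_on_comp (@box_norm_on R _ n n0) Gfree.
have [U [uU hU _]] := hC1 _ hM; set M := (fun x => _) in hU hM.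
pose n' i := (Num.trunc (C1 * d.+2%:R / M (toR R (row i U)))).+1.
have [//|s hs sz] := IH n' rho _ rho0.
have UGfree : row_free (toR R (U *m G)).
  rewrite map_mxM row_free_mul // row_free_unit.
  exact: toR_unitmx.
have [|s' hs' sz'] := covers_map (Q := fun x => x \in slice n z) UGfree hs.
  move=> x; rewrite mem_filter => /andP [/eqP xz xn].
  have [y xE] := Gz x xz; exists (y *m invmx U); last by rewrite mulmxA mulmxKV.
  apply/mem_box => i; rewrite /n' -ltnS -(ltr_nat R) natr_absz intr_norm.
  have N0 : 0 < M (toR R (row i U)).
    apply: norm_on_gt0 => //; rewrite map_row row_free_neq0 // row_free_unit.
    exact: toR_unitmx.
  apply: (@le_lt_trans _ _ (C1 * d.+2%:R / M (toR R (row i U)))).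
    rewrite ler_pdivlMr //; have := hU (toR R (y *m invmx U)) i.
    rewrite mxE => h; apply: le_trans h _; rewrite ler_wpM2l ?(le_trans _ C11) //.
    by rewrite /M -!map_mxM mulmxKV // -xE box_norm_le.
  by apply: lt_trans (truncnS_gt _) _; rewrite ltr_nat.
exists s' => //; rewrite sz'; apply: leq_trans sz _.
rewrite -mulnA leq_mul2l mulnDr leq_add ?orbT // ?leq_pmull //.
apply: (@leq_trans (C2 * size (slice n z))); last by rewrite leq_mul2r leqnSn orbT.
apply: (hC2 _ _ _ (fun w => w *m (U *m G))) => // [w w' h|w].
  apply: (@toR_inj R); apply: (row_free_inj UGfree).
  by rewrite -!map_mxM h.
rewrite /M -map_mxM -mulmxA => h; rewrite mem_filter (box_norm_mem n0 h) andbT.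
by rewrite mulmxA zG.
Qed.

Lemma covers_union (R : realType) d k (T : eqType) (t : seq T)
    (P : T -> 'rV[int]_d -> Prop) (c : nat) (b : T -> nat) :
  (forall z, z \in t -> exists2 s : seq 'M[R]_(k, d), covers_ints s (P z) &
     (size s * c <= b z)%N) ->
  exists2 s : seq 'M[R]_(k, d),
    covers_ints s (fun x => exists2 z, z \in t & P z x) &
    (size s * c <= \sum_(z <- t) b z)%N.
Proof.
elim: t => [|z t IHt] h.
  by exists [::] => //; apply/covers_intsP; split=> // x [].
have [|s1 hs1 sz1] := IHt; first by move=> y yt; apply: h; rewrite inE yt orbT.
have [s2 hs2 sz2] := h z (mem_head _ _).
exists (s2 ++ s1); last by rewrite size_cat mulnDl big_cons leq_add.
move/covers_intsP: hs1 => [f1 c1]; move/covers_intsP: hs2 => [f2 c2].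
apply/covers_intsP; split=> [U|x [y]].
  by rewrite mem_cat => /orP [/f2|/f1].
rewrite inE => /orP [/eqP -> Px|yt Px].
  by have [U Us xU] := c2 x Px; exists U; rewrite // mem_cat Us.
have [|U Us xU] := c1 x; first by exists y.
by exists U; rewrite // mem_cat Us orbT.
Qed.

(** The least r with B V <= r^(d+1) works: B > 1 forces r >= 2, so r <= 2 (r-1), and r-1 fails the
    inequality. *)
Lemma critical_radius B V d : (1 < B)%N -> (0 < V)%N ->
  exists2 r : nat, (B * V <= r ^ d.+1)%N & (r ^ d.+1 <= 2 ^ d.+1 * B * V)%N.
Proof.
move=> B1 V0; have BV : (1 < B * V)%N by rewrite (leq_trans B1) ?leq_pmulr.
have exP : exists r, (B * V <= r ^ d.+1)%N.
  by exists (B * V)%N; rewrite expnS leq_pmulr // expn_gt0 ltnW.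
case: (ex_minnP exP) => r hr hmin; exists r => //.
have r1 : (1 < r)%N by case: r hr {hmin} => [|[|r]] //; rewrite ?exp0n ?exp1n // leqNgt ?BV // ltnW.
have : ~~ (B * V <= r.-1 ^ d.+1)%N by apply/negP => /hmin; lia.
rewrite -ltnNge -mulnA => /ltnW h; apply: (@leq_trans ((2 * r.-1) ^ d.+1)).
  by rewrite leq_exp2r //; lia.
by rewrite expnMn leq_mul2l h orbT.
Qed.

(** The induction is for all [k] at once: dropping a coordinate lowers both dimensions, passing to a
    hyperplane only the ambient one. *)
Lemma box_cover (R : realType) d : forall k, (k <= d)%N -> exists C : nat,
  forall (n : 'I_d.+1 -> nat) rho, (forall i, 0 < n i)%N -> (0 < rho)%N ->
    exists2 s : seq 'M[R]_(k.+1, d.+1), covers_ints s (fun x => x \in box n) &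
      (size s * rho ^ k <= C * (\prod_i n i + rho ^ d))%N.
Proof.
elim: d => [|d IH] k kd.
  move: kd; rewrite leqn0 => /eqP ->; exists 1%N => n rho n0 rho0.
  exists [:: 1%:M]; last by rewrite /= mul1n mul1n leq_addl.
  apply/covers_intsP; split=> [U|x _].
    by rewrite inE => /eqP ->; rewrite row_free_unit unitmx1.
  by exists 1%:M; rewrite ?mem_head ?submx1.
case: k kd => [|k] kd.
  exists (3 ^ d.+2)%N => n rho n0 rho0.
  have [s hs sz] := covers_points R (box n); exists s => //.
  rewrite sz muln1 mulnDr; apply: leq_trans (leq_addr _ _).
  by apply: size_box_le => i; have := n0 i; lia.
have [->|kd'] := eqVneq k.+1 d.+1.
  exists 1%N => n rho n0 rho0.
  exists [:: 1%:M]; last by rewrite /= mul1n mul1n leq_addl.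
  apply/covers_intsP; split=> [U|x _].
    by rewrite inE => /eqP ->; rewrite row_free_unit unitmx1.
  by exists 1%:M; rewrite ?mem_head ?submx1.
have {kd'}kd : (k.+1 <= d)%N by rewrite -ltnS ltn_neqAle kd' kd.
have [Ca hCa] := IH k (ltnW kd).
have [Cb hCb] := IH k.+1 kd; have [Cs hCs] := slice_cover hCb.
(* [B] is the constant of [orthogonal_in_box], [A] that of [critical_radius], and [S] that of
   [sum_slices], all in dimension d+2. *)
pose B := (2 * d.+2).+1; pose A := (2 ^ d.+1 * B)%N.
pose S := (9 ^ d.+2 + d.+2 ^ 2 * (3 ^ d.+2 * (2 * A + 3) ^ d.+2 * A))%N.
pose C0 := (Ca * (1 + A) + Cs * (S + 3 ^ d.+2 * A * A))%N.
(* The critical r suffices. A smaller rho only decreases the left side; for a larger one, the bound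
   says s <= C0 r^(d-k), which is at most C0 rho^(d-k). *)
suff main (n : 'I_d.+2 -> nat) r : (forall i, 0 < n i)%N ->
    (B * \prod_i n i <= r ^ d.+1)%N -> (r ^ d.+1 <= A * \prod_i n i)%N ->
    exists2 s : seq 'M[R]_(k.+2, d.+2), covers_ints s (fun x => x \in box n) &
      (size s * r ^ k.+1 <= C0 * \prod_i n i)%N.
  exists C0 => n rho n0 rho0; set V := (\prod_i n i)%N.
  have V0 : (0 < V)%N by apply: prodn_gt0.
  have [//|r hr1 hr2] := @critical_radius B V d _ V0.
  have [s hs sz] := main n r n0 hr1 hr2; exists s => //; rewrite -/V in sz.
  have [rr|rr] := leqP rho r.
    apply: (@leq_trans (C0 * V)); last by rewrite leq_mul2l leq_addr orbT.
    by apply: leq_trans sz; rewrite leq_mul2l leq_exp2r // rr orbT.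
  have r0 : (0 < r)%N by case: (r) hr1 => //; rewrite exp0n // leqn0 muln_eq0 -(negbK (V == 0)%N) -lt0n V0.
  have szr : (size s <= C0 * r ^ (d.+1 - k.+1))%N.
    rewrite -(@leq_pmul2r (r ^ k.+1)) ?expn_gt0 ?r0 // -mulnA -expnD (subnK (leqW kd)).
    by apply: leq_trans sz _; rewrite leq_mul2l (leq_trans _ hr1) ?orbT // leq_pmull.
  apply: (@leq_trans (C0 * rho ^ d.+1)); last by rewrite leq_mul2l leq_addl orbT.
  rewrite -[in X in (_ <= X)%N](subnK (leqW kd)).
  rewrite expnD mulnA leq_mul2r (leq_trans szr) ?orbT // leq_mul2l leq_exp2r ?subn_gt0 //.
  by rewrite ltnW ?orbT.
move=> n0 hr1 hr2; set V := (\prod_i n i)%N in hr1 hr2 *.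
have V0 : (0 < V)%N by apply: prodn_gt0.
have r0 : (0 < r)%N by case: (r) hr1 => //; rewrite exp0n // leqn0 muln_eq0 -(negbK (V == 0)%N) -lt0n V0.
have [/existsP [i hi]|] := boolP [exists i, (r < n i)%N].
  (* Without coordinate [i] the volume is V / n_i < V / r, so multiplying the bound for [k] by r
     gives Ca (V + r^(d+1)). *)
  have [//|s hs sz] := hCa (fun j => n (lift i j)) r _ r0.
  have [s' hs' sz'] := covers_lift hs.
  exists s' => //; rewrite sz' expnSr mulnA.
  apply: (@leq_trans (Ca * (1 + A) * V)); last by rewrite leq_mul2r leq_addr orbT.
  apply: leq_trans (leq_mul sz (leqnn r)) _; rewrite -!mulnA leq_mul2l mulnDl.
  apply/orP; right; rewrite mulnDl mul1n; apply: leq_add; last by rewrite -expnSr.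
  rewrite /V (bigD1_ord i) //= mulnC leq_mul2r ltnW ?orbT //.
rewrite negb_exists => /forallP hi.
have hn i : (0 < n i <= r)%N by rewrite n0 leqNgt hi.
have hz z : z \in hyperplanes n r -> exists2 s : seq 'M[R]_(k.+2, d.+2),
    covers_ints s (fun x => x \in slice n z) &
    (size s * r ^ k.+1 <= Cs * (size (slice n z) + r ^ d))%N.
  move=> zh; apply: hCs => //; move: zh; rewrite mem_filter => /andP [/asboolP [u uz] _].
  apply/eqP => z0; move: uz; rewrite z0 /dotz big1 // => i _.
  by rewrite mxE mulr0.
have [s hs sz] := covers_union hz; exists s.
  apply/covers_intsP; have [hfree hcov] := iffLR (covers_intsP _ _) hs.
  split=> // x xn; apply: hcov.
  have [z [zm pz xz]] := orthogonal_in_box n0 hr1 xn.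
  by exists z; rewrite mem_filter ?pz // xn xz eqxx.
(* The slice sizes add up to at most S V, and the O(r) terms r^d to O(r^(d+1)) = O(V). *)
apply: leq_trans sz _; rewrite -big_distrr /= big_split /=.
rewrite big_const_seq count_predT iter_addn_0 [(r ^ d * _)%N]mulnC.
apply: (@leq_trans (Cs * (S + 3 ^ d.+2 * A * A) * V)); last first.
  by rewrite leq_mul2r leq_addl orbT.
rewrite -mulnA leq_mul2l mulnDl leq_add ?orbT //.
  exact: sum_slices.
have sh := size_hyperplanes hn hr2.
apply: leq_trans (leq_mul sh (leqnn (r ^ d))) _.
by rewrite -mulnA -expnS -[X in (_ <= X)%N]mulnA leq_mul2l hr2 orbT.
Qed.
(** * The gauge of a convex body and successive minima *)

Section Gauge.
Variables (R : realType) (d : nat) (K : set 'rV[R]_d).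
Hypothesis hK : sym_convex_body K.

Lemma body_bounded : exists2 M : R, 0 < M & forall y i, K y -> `|y 0 i| <= M.
Proof.
have [cK _] := hK.
have /fin_all_exists [M hM] : forall i : 'I_d, exists M : R, 0 < M /\
    forall y, K y -> `|y 0 i| <= M.
  move=> i; have cKi : compact [set y 0 i | y in K].
    apply: (@continuous_compact _ _ (fun y : 'rV[R]_d => y 0 i)) => //.
    by apply: continuous_subspaceT => y; exact: coord_continuous.
  have := @compact_bounded R R^o _ cKi.
  move/pinfty_ex_gt0 => [M M0 hM]; exists M; split=> // y Ky.
  by apply: hM; exists y.
exists (1 + \sum_i M i) => [|y i Ky].
  by rewrite ltr_pwDl // sumr_ge0 // => i _; apply: ltW; have [] := hM i.
have [_ /(_ y Ky) h] := hM i; apply: le_trans h _.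
rewrite (bigD1 i) //= addrCA lerDl addr_ge0 // sumr_ge0 // => j _.
by apply: ltW; have [] := hM j.
Qed.

Lemma body_ball : exists2 e : R, 0 < e &
  forall v : 'rV[R]_d, (forall i, `|v 0 i| < e) -> K v.
Proof.
have [_ [cv [sK [p /nbhs_ballP [e /= e0 he]]]]] := hK.
have Kp : K p by apply: he; exact: ballxx.
(* A small v is the midpoint of p + 2v and -p, for p an interior point. *)
exists (e / 2) => [|v hv]; first by rewrite divr_gt0.
have Kq : K (p + 2 *: v).
  apply: he; split=> // i j; rewrite (ord1 i) !mxE /ball /= opprD addrA subrr add0r normrN.
  by rewrite normrM ger0_norm // mulrC -ltr_pdivlMr.
have -> : v = (1 / 2) *: (p + 2 *: v) + (1 - 1 / 2) *: - p.
  by apply/rowP => i; rewrite !mxE; lra.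
by apply: cv => //; [exact: sK|apply/andP; split; lra].
Qed.

Lemma body0 : K 0.
Proof. by have [e e0] := body_ball; apply=> i; rewrite mxE normr0. Qed.

Definition gauge (x : 'rV[R]_d) : R :=
  inf [set r | 0 < r /\ exists2 y, K y & x = r *: y].

Lemma gauge_le r x y : 0 < r -> K y -> x = r *: y -> gauge x <= r.
Proof.
move=> r0 Ky xE; apply: ge_inf; last by split=> //; exists y.
by exists 0 => s [/ltW].
Qed.

Lemma gauge_nonempty x : [set r : R | 0 < r /\ exists2 y, K y & x = r *: y] !=set0.
Proof.
have [e e0 he] := body_ball.
have S0 : 0 < 1 + \sum_j `|x 0 j| by rewrite ltr_pwDl // sumr_ge0.
pose r := (1 + \sum_j `|x 0 j|) / e; have r0 : 0 < r by rewrite divr_gt0.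
exists r; split=> //; exists (r^-1 *: x); last by rewrite scalerA divff ?scale1r ?gt_eqF.
apply: he => i; rewrite mxE normrM ger0_norm ?invr_ge0 ?ltW //.
rewrite mulrC ltr_pdivrMr // /r mulrCA divff ?gt_eqF // mulr1.
by rewrite (bigD1 i) //= addrCA ltrDl ltr_pwDl // sumr_ge0.
Qed.

Lemma gauge_glb s x : (forall r y, 0 < r -> K y -> x = r *: y -> s <= r) -> s <= gauge x.
Proof.
move=> h; apply: lb_le_inf; first exact: gauge_nonempty.
by move=> r [r0 [y Ky xE]]; exact: h xE.
Qed.

(** The infimum yields x = s y with s < r, and (s / r) y is in [K] by convexity with 0. *)
Lemma gauge_lt r x : gauge x < r -> exists2 y, K y & x = r *: y.
Proof.
have [_ [cv _]] := hK.
move=> xr; have [||s [s0 [y Ky xE]] hs] :=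
    @inf_adherent R [set r | 0 < r /\ exists2 y, K y & x = r *: y] (r - gauge x).
- by rewrite subr_gt0.
- by split; [exact: gauge_nonempty|exists 0 => s [/ltW]].
rewrite -/(gauge x) addrC subrK in hs; have r0 := lt_trans s0 hs.
exists ((s / r) *: y + (1 - s / r) *: 0).
  apply: cv => //; first exact: body0.
  by rewrite divr_ge0 ?(ltW s0) ?(ltW r0) //= ler_pdivrMr // mul1r ltW.
by rewrite scaler0 addr0 scalerA mulrCA divff ?gt_eqF // mulr1.
Qed.

Lemma gauge_norm_on : norm_on gauge.
Proof.
have [_ [cv [sK _]]] := hK; split.
- move=> x y; rewrite -lerBlDr; apply: gauge_glb => r a r0 Ka xE.
  rewrite lerBlDr -lerBlDl; apply: gauge_glb => s b s0 Kb yE.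
  have rs0 : 0 < r + s by rewrite addr_gt0.
  rewrite lerBlDl; apply: (@gauge_le _ _ ((r / (r + s)) *: a + (1 - r / (r + s)) *: b)) => //.
    apply: cv => //; rewrite divr_ge0 ?(ltW r0) ?(ltW rs0) //=.
    by rewrite ler_pdivrMr // mul1r lerDl ltW.
  rewrite scalerDr !scalerA mulrBr mulrCA divff ?gt_eqF // !mulr1.
  by rewrite [r + s]addrC addrK -xE -yE.
- move=> a x; have [->|a0] := eqVneq a 0.
    rewrite normr0 mul0r scale0r; apply/ler_addgt0Pr => e e0.
    by rewrite add0r; apply: (@gauge_le _ _ 0); rewrite ?scaler0 //; exact: body0.
  rewrite -ler_pdivrMl ?normr_gt0 //; apply: gauge_glb => r y r0 Ky xE.
  (* The sign of [a] is absorbed into the point of [K] by symmetry. *)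
  rewrite ler_pdivrMl ?normr_gt0 //; apply: (@gauge_le _ _ (Num.sg a *: y)).
  + by rewrite mulr_gt0 ?normr_gt0.
  + rewrite /Num.sg (negPf a0); case: ifP => _; last by rewrite scale1r.
    by rewrite scaleN1r; exact: sK.
  by rewrite xE !scalerA mulrAC [`|a| * _]mulrC -numEsg.
have [M M0 hM] := body_bounded; exists M^-1; first by rewrite invr_gt0.
move=> x i; apply: gauge_glb => r y r0 Ky ->.
rewrite mxE normrM gtr0_norm // mulrCA ler_piMr ?(ltW r0) // mulrC ler_pdivrMr // mul1r.
exact: hM.
Qed.

End Gauge.

Lemma row_free_rowsub (F : fieldType) m m' d (f : 'I_m' -> 'I_m) (A : 'M[F]_(m, d)) :
  injective f -> row_free A -> row_free (rowsub f A).
Proof.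
move=> finj /row_freeP [B AB]; apply/row_freeP; exists (colsub f B).
rewrite -mxsub_mul AB; apply/matrixP => i j.
by rewrite !mxE (inj_eq finj).
Qed.

Lemma affdim_geS (R : realType) d (S : set 'rV[R]_d) i j :
  (i <= j)%N -> affdim_ge S j -> affdim_ge S i.
Proof.
move=> ij [x0 [Sx0 [X [Xfree hX]]]]; exists x0; split=> //.
exists (rowsub (widen_ord ij) X); split.
  by apply: row_free_rowsub => // a b /(congr1 val) /= ab; exact: val_inj.
by move=> r; rewrite row_rowsub; exact: hX.
Qed.

Section SuccessiveMinima.
Variables (R : realType) (d : nat) (K : set 'rV[R]_d) (B : 'M[R]_d).
Hypotheses (hK : sym_convex_body K) (uB : \det B != 0).

Let L := [set v | exists z : 'rV[int]_d, v = toR R z *m B].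
Let N (x : 'rV[R]_d) := gauge K (x *m B).

Lemma lattice_norm_on : norm_on N.
Proof.
apply: norm_on_comp; first exact: gauge_norm_on.
by rewrite row_free_unit unitmxE unitfE.
Qed.

(** The base point is 0, and the independent directions are the first i+1 basis vectors; the strict
    inequality puts them in lam K through [gauge_lt]. *)
Lemma affdim_ge_basis (U : 'M[int]_d) (i : 'I_d) lam : 0 < lam -> U \in unitmx ->
  (forall j : 'I_d, (j <= i)%N -> N (toR R (row j U)) < lam) ->
  affdim_ge (L `&` [set lam *: x | x in K]) i.+1.
Proof.
move=> lam0 uU h; exists 0; split.
  split; first by exists 0; rewrite map_mx0 mul0mx.
  by exists 0; [exact: body0|rewrite scaler0].
pose f := widen_ord (ltn_ord i).
exists (rowsub f (toR R U *m B)); split.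
  apply: row_free_rowsub; first by move=> a b /(congr1 val) /= ab; exact: val_inj.
  by rewrite row_free_mul // row_free_unit ?toR_unitmx // unitmxE unitfE.
move=> r; rewrite add0r row_rowsub row_mul -map_row; split; first by exists (row (f r) U).
have [//|y Ky yE] := @gauge_lt _ _ _ hK lam (toR R (row (f r) U) *m B).
  by apply: h; rewrite /= -ltnS.
by exists y.
Qed.

(** A set of positive affine dimension contains a nonzero lattice point, either the base point or
    its translate by a direction. *)
Lemma affdim_ge_gt0 : exists2 c : R, 0 < c & forall i lam, (0 < i)%N -> 0 < lam ->
  affdim_ge (L `&` [set lam *: x | x in K]) i -> c <= lam.
Proof.
have [c c0 hc] := int_row_norm_ge lattice_norm_on; exists c => // i lam i0 lam0.
have key v : (L `&` [set lam *: x | x in K]) v -> v != 0 -> c <= lam.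
  move=> [[z ->] [y Ky yE]] v0; apply: le_trans (hc z _) _.
    by apply: contra_neq v0 => ->; rewrite map_mx0 mul0mx.
  by apply: (@gauge_le _ _ _ _ _ y).
move=> [x0 [hx0 [X [Xfree hX]]]].
have [x00|] := eqVneq x0 0; last exact: key.
by apply: (key _ (hX (Ordinal i0))); rewrite x00 add0r row_free_neq0.
Qed.

Lemma succ_min_le i lam : (0 < i)%N -> 0 < lam ->
  affdim_ge (L `&` [set lam *: x | x in K]) i -> succ_min L K i <= lam.
Proof.
move=> i0 lam0 h; apply: ge_inf; last by split.
by exists 0 => s [/ltW].
Qed.

Variables (C : R) (U : 'M[int]_d).
Hypotheses (C1 : 1 <= C) (uU : U \in unitmx).
Hypothesis hmono : forall i j : 'I_d, (i <= j)%N ->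
  N (toR R (row i U)) <= C * N (toR R (row j U)).

Let N0 i : 0 < N (toR R (row i U)).
Proof.
apply: norm_on_gt0; first exact: lattice_norm_on.
by rewrite map_row row_free_neq0 // row_free_unit toR_unitmx.
Qed.

(** The factor 2 turns the monotonicity of the basis norms into a strict inequality. *)
Lemma succ_min_basis_mem (i : 'I_d) :
  affdim_ge (L `&` [set (2 * C * N (toR R (row i U))) *: x | x in K]) i.+1.
Proof.
have Ni := N0 i; have CN : 0 < C * N (toR R (row i U)) by rewrite mulr_gt0 // (lt_le_trans _ C1).
apply: (affdim_ge_basis _ uU); first by rewrite -mulrA mulr_gt0.
by move=> j ji; apply: le_lt_trans (hmono ji) _; lra.
Qed.

Let lam0 (i : 'I_d) : 0 < 2 * C * N (toR R (row i U)).
Proof. by rewrite !mulr_gt0 // (lt_le_trans _ C1). Qed.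

Lemma succ_min_basis (i : 'I_d) :
  succ_min L K i.+1 <= 2 * C * N (toR R (row i U)).
Proof. by apply: succ_min_le => //; exact: succ_min_basis_mem. Qed.

Lemma succ_min_gt0 (i : 'I_d) : 0 < succ_min L K i.+1.
Proof.
have [c c0 hc] := affdim_ge_gt0; apply: lt_le_trans c0 _.
apply: lb_le_inf => [|lam [l0 hlam]]; last exact: hc hlam.
(* The set of dilations must be nonempty for its infimum to inherit the lower bound. *)
by exists (2 * C * N (toR R (row i U))); split=> //; exact: succ_min_basis_mem.
Qed.

Lemma succ_min_le_last (i : 'I_d) : succ_min L K i.+1 <= succ_min L K d.
Proof.
have d0 : (0 < d)%N by apply: leq_ltn_trans (ltn_ord i).
have hd : (d.-1 < d)%N by rewrite prednK.
apply: lb_le_inf => [|lam [l0 hlam]].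
  exists (2 * C * N (toR R (row (Ordinal hd) U))); split=> //.
  by have := succ_min_basis_mem (Ordinal hd); rewrite /= prednK.
by apply: succ_min_le => //; exact: affdim_geS hlam.
Qed.
End SuccessiveMinima.

(** * From boxes to lattice points *)

Lemma covers_drop (R : realType) j d k (n : nat -> nat) (s : seq 'M[R]_(k, d)) :
  covers_ints s (fun x => x \in box (fun i : 'I_d => n (j + i)%N)) ->
  exists2 s' : seq 'M[R]_(j + k, j + d),
    covers_ints s' (fun x => x \in box (fun i : 'I_(j + d) => n i)) &
    size s' = size s.
Proof.
elim: j n => [|j IHj] n hs; first by exists s.
have [s1 hs1 sz1] := IHj (fun i => n i.+1) hs.
have [s2 hs2 sz2] := @covers_lift R _ _ ord0 (fun i => n i) s1 hs1.
by exists s2 => //; rewrite sz2.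
Qed.

Lemma alpha_eq_term (R : realType) d k (L K : set 'rV[R]_d) : (0 < k)%N ->
  exists j : 'I_k, alpha k L K = alpha_term L K j.+1.
Proof.
move=> k0; rewrite /alpha big_nat_cond.
apply: (big_ind (fun x => exists j : 'I_k, x = alpha_term L K j.+1)).
- by exists (Ordinal k0).
- by move=> x y hx hy; rewrite /Num.min; case: ifP.
move=> i /andP [/andP [i1 ik] _].
have ik' : (i.-1 < k)%N by rewrite prednK.
by exists (Ordinal ik'); rewrite /= prednK.
Qed.

(* [P] stands for lambda_(j+1) ... lambda_d, [a] for the corresponding
   [alpha_term], and [n i] for the integer part of [A / lambda_(i+1)]. *)
Lemma cover_tail (R : realType) d k (j : 'I_k) : (k < d)%N -> exists C : nat,
  forall (n : nat -> nat) (A a P : R), (forall i, (i < d)%N -> 0 < n i)%N ->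
  1 <= A -> 1 <= a -> a ^+ (d - j.+1) * P = 1 ->
  (\prod_(j <= i < d) n i)%:R * P <= A ^+ (d - j) ->
  exists2 s : seq 'M[R]_(k, d), covers_ints s (fun x => x \in box (fun i : 'I_d => n i)) &
    (size s)%:R <= C%:R * A ^+ (2 * (d - k)) * a ^+ (d - k).
Proof.
move=> kd; have jk := ltn_ord j.
(* After j coordinates are dropped, a box in dimension D+1 is to be covered by subspaces of
   dimension Q+1, with D - Q = d - k. *)
have [D dE] : exists D, d = (j + D.+1)%N by exists (d - j.+1)%N; lia.
have [Q kE] : exists Q, k = (j + Q.+1)%N by exists (k - j.+1)%N; lia.
move: (nat_of_ord j) jk dE kE => {}j jk dE kE.
have QD : (Q < D)%N by lia.
rewrite {}dE {}kE {kd jk d k}.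
have [C hC] := box_cover R (ltnW QD).
exists (C * 2 * 2 ^ (D - Q))%N => n A a P n0 A1 a1 aP VP.
have -> : (j + D.+1 - (j + Q.+1) = D - Q)%N by lia.
move: aP VP; have -> : (j + D.+1 - j.+1 = D)%N by lia.
have -> : (j + D.+1 - j = D.+1)%N by lia.
rewrite -{1}[j]add0n big_addn (_ : (j + D.+1 - j = D.+1)%N); last by lia.
rewrite big_mkord (eq_bigr (fun i : 'I_D.+1 => n (j + i)%N)) => [aP VP|i _]; last first.
  by rewrite addnC.
(* Since a^D P = 1, the volume V of the remaining box satisfies V = V P a^D <= A^(D+1) a^D <= (A^2
   a)^D, using D >= 1. So V <= rho^D, and [box_cover] gives at most 2 C rho^(D-Q) subspaces. *)
pose rho := (Num.trunc (A ^+ 2 * a)).+1.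
have A2a : 1 <= A ^+ 2 * a by rewrite mulr_ege1 // exprn_ege1.
have rho_gt : A ^+ 2 * a < rho%:R by exact: truncnS_gt.
have rho_le : rho%:R <= 2 * (A ^+ 2 * a).
  have : (Num.trunc (A ^+ 2 * a))%:R <= A ^+ 2 * a by rewrite truncn_le; lra.
  by rewrite /rho -natr1; lra.
have Vrho : (\prod_(i < D.+1) n (j + i) <= rho ^ D)%N.
  rewrite -(ler_nat R) natrX; apply: (@le_trans _ _ ((A ^+ 2 * a) ^+ D)).
    rewrite -[X in X <= _]mulr1 -[X in _ * X <= _]aP [_ ^+ D * P]mulrC mulrA exprMn.
    rewrite ler_wpM2r ?exprn_ge0 // ?(le_trans _ a1) //.
    apply: le_trans VP _; rewrite -exprM ler_weXn2l //; lia.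
  by rewrite lerXn2r ?nnegrE ?(ltW rho_gt) //; lra.
have [i|//|s hs sz] := hC (fun i : 'I_D.+1 => n (j + i)%N) rho.
  by apply: n0; rewrite ltn_add2l.
have [s' hs' sz'] := covers_drop hs; exists s' => //; rewrite sz'.
have szr : (size s <= C * 2 * rho ^ (D - Q))%N.
  rewrite -(@leq_pmul2r (rho ^ Q)) ?expn_gt0 // -mulnA -expnD (subnK (ltnW QD)).
  apply: leq_trans sz _; rewrite -mulnA leq_mul2l mul2n -addnn leq_add2r.
  by rewrite Vrho orbT.
apply: (@le_trans _ _ ((C * 2 * rho ^ (D - Q))%N)%:R); first by rewrite ler_nat.
rewrite natrM natrX [(C * 2 * _)%:R]natrM natrX -!mulrA ler_wpM2l //.
rewrite exprM -!exprMn lerXn2r ?nnegrE ?mulr_ge0 //; lra.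
Qed.

Theorem theorem3 (R : realType) (d k : nat) :
  (1 <= k)%N -> (k <= d - 1)%N ->
  exists C : R, 0 < C /\
    forall (L K : set 'rV[R]_d),
      is_lattice L -> sym_convex_body K ->
      succ_min L K d <= 1 ->
      exists s : seq 'M[R]_(k, d),
        covers_by_subspaces s (L `&` K) /\
        (size s)%:R <= C * alpha k L K ^+ (d - k).
Proof.
move=> k1 kd1; have kd : (k < d)%N by lia.
have [C1 C11 hC1] := reduced_basis R d.
have /fin_all_exists [Cs hCs] := fun j : 'I_k => cover_tail R j kd.
(* A coordinate w_i of a point of [K] satisfies |w_i| N(u_i) <= C1, and the minimum is at most 2 C1
   N(u_i); [A] is the product of the two constants. *)
pose A := 2 * C1 ^+ 2; have A1 : 1 <= A.
  by have := exprn_ege1 2 C11; rewrite /A; lra.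
(* The sum dominates the constant of whichever term attains the minimum; the 1 keeps it positive. *)
exists ((1 + \sum_j Cs j)%:R * A ^+ (2 * (d - k))); split.
  by rewrite mulr_gt0 ?ltr0n // exprn_gt0 //; lra.
move=> L K [B [uB LE]] hK lamd; subst L; set L := [set v | _] in lamd *.
have hN := lattice_norm_on hK uB; set N := (fun x => _) in hN.
have [U [uU hU hmono]] := hC1 _ hN.
have lam_gt0 (i : 'I_d) : 0 < succ_min L K i.+1 by exact: succ_min_gt0 hmono i.
(* All minima being at most 1 makes every side [n i] positive and the chosen term of [alpha] at
   least 1. *)
have lam_le1 (i : 'I_d) : succ_min L K i.+1 <= 1.
  by apply: le_trans lamd; exact: succ_min_le_last hmono i.
have lamN (i : 'I_d) : succ_min L K i.+1 <= 2 * C1 * N (toR R (row i U)).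
  by exact: succ_min_basis hmono i.
have [j ->] := alpha_eq_term L K k1.
pose n i := Num.trunc (A / succ_min L K i.+1).
pose P := \prod_(j.+1 <= i < d.+1) succ_min L K i.
pose lam i := succ_min L K i.+1.
have PE : P = \prod_(j <= i < d) lam i by rewrite /P big_add1.
have l0 i : (i < d)%N -> 0 < lam i by move=> hi; exact: (lam_gt0 (Ordinal hi)).
have l1 i : (i < d)%N -> lam i <= 1 by move=> hi; exact: (lam_le1 (Ordinal hi)).
have P0 : 0 < P.
  by rewrite PE big_nat; apply: prodr_gt0 => i /andP [_ /l0].
have P1 : P <= 1.
  rewrite PE big_nat; apply: prodr_ile1 => i /andP [_ hi].
  by rewrite ltW ?l0 ?l1.
have D0 : (d - j.+1)%N != 0%N by have := ltn_ord j; lia.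
have aP : alpha_term L K j.+1 ^+ (d - j.+1) * P = 1.
  rewrite /alpha_term -/P -powR_mulrn ?powR_ge0 // -powRrM mulNr mulVf ?pnatr_eq0 //.
  by rewrite powR_inv1 ?ltW // mulVf ?gt_eqF.
have a1 : 1 <= alpha_term L K j.+1.
  rewrite leNgt; apply/negP => h; have := oner_neq0 R.
  have aD : alpha_term L K j.+1 ^+ (d - j.+1) < 1 by rewrite exprn_ilt1 ?powR_ge0.
  have : alpha_term L K j.+1 ^+ (d - j.+1) * P <= alpha_term L K j.+1 ^+ (d - j.+1).
    by rewrite ler_piMr // exprn_ge0 // powR_ge0.
  by rewrite aP; lra.
have nlam i : (i < d)%N -> (n i)%:R * lam i <= A.
  move=> hi; rewrite -ler_pdivlMr ?l0 // truncn_le divr_ge0 ?(ltW (l0 _ hi)) //.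
  by lra.
have n0 i : (i < d)%N -> (0 < n i)%N.
  move=> hi; rewrite truncn_gt0 ler_pdivlMr ?l0 // mul1r.
  exact: le_trans (l1 _ hi) A1.
have VP : (\prod_(j <= i < d) n i)%:R * P <= A ^+ (d - j).
  rewrite PE natr_prod -big_split /= -prodr_const_nat big_nat [X in _ <= X]big_nat.
  apply: ler_prod => i /andP [_ hi]; rewrite nlam // andbT mulr_ge0 //.
  exact: ltW (l0 _ hi).
have [s /covers_intsP [sfree hs] sz] := hCs j n A _ P n0 A1 a1 aP VP.
have UBfree : row_free (toR R U *m B).
  by rewrite row_free_mul // row_free_unit ?toR_unitmx // unitmxE unitfE.
(* The subspaces are carried from reduced-basis coordinates back to the ambient space. *)
exists [seq V *m (toR R U *m B) | V : 'M[R]_(k, d) <- s]; split; last first.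
  rewrite size_map; apply: le_trans sz _.
  rewrite !ler_wpM2r ?exprn_ge0 ?(le_trans ler01 a1) ?(le_trans ler01 A1) //.
  by rewrite ler_nat (bigD1 j) //= addnCA leq_addr.
split=> [_ /mapP [V Vs ->]|v [[z vE] Kv]]; first by rewrite row_free_mul ?sfree.
pose w := z *m invmx U; have zE : z = w *m U by rewrite mulmxKV.
have [|V Vs wV] := hs w.
  apply/mem_box => i; rewrite truncn_ge_nat; last first.
    by rewrite divr_ge0 // ?(ltW (lam_gt0 i)) //; lra.
  have Nv : N (toR R z) <= 1.
    by apply: (@gauge_le _ _ _ _ _ v); rewrite // scale1r vE.
  have := hU (toR R w) i; rewrite -map_mxM -zE mxE -intr_norm -natr_absz => h.
  rewrite ler_pdivlMr //.
  apply: (@le_trans _ _ (`|w 0%R i|%N%:R * (2 * C1 * N (toR R (row i U))))).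
    by rewrite ler_wpM2l.
  have h2 : `|w 0%R i|%N%:R * N (toR R (row i U)) <= C1.
    by apply: le_trans h _; rewrite ler_piMr // (le_trans ler01 C11).
  rewrite mulrCA /A expr2 -!mulrA ler_pM2l // ler_pM2l //.
  exact: lt_le_trans C11.
exists (V *m (toR R U *m B)); first by apply/mapP; exists V.
by rewrite vE zE map_mxM -mulmxA submxMr.
Qed.
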